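(* Let $S$ be a closed surface with a cellular decomposition $\Sigma=(V,E,F)$ in which every face has an even number of edges and every vertex has even degree, let $q\in(0,1]$, and let $\hat L=(\hat L_1,\dots,\hat L_{|F|})\in\mathbb{R}^{|F|}_{>0}$. Consider on the admissible space $U$ the combinatorial Ricci flow $$\frac{\mathrm{d}u_i}{\mathrm{d}t}=L_i-\hat L_i,\quad i\in\{1,\dots,|F|\},\qquad (\mathrm{RF})$$ and the combinatorial Calabi flow $$\frac{\mathrm{d}u_i}{\mathrm{d}t}=-(\Delta(L-\hat L))_i,\quad i\in\{1,\dots,|F|\},\qquad (\mathrm{CF})$$ where $\Delta=\left(\frac{\partial L_i}{\partial u_j}\right)_{|F|\times|F|}$. (1) If a solution $u(t)$ of (RF) or of (CF) exists for all time $t\ge 0$ and converges to some $\hat u\in U$ as $t\to+\infty$, then $L(\hat u)=\hat L$. (2) If $\hat L$ is attainable, i.e. $L(\hat u)=\hat L$ for some $\hat u\in U$, then there exists a neighborhood $\tilde U\subset U$ of $\hat u$ such that for any initial value $u(0)\in\tilde U$, the solutions of (RF) and (CF) exist for all time and converge exponentially fast to $\hat u$.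
   Context: $V,E,F$ are the (finite) sets of vertices, edges and faces of $\Sigma$; faces are $f_1,\dots,f_{|F|}$, each being a polygon with a positive even number of edges. Write $e<f_i$ if $e$ is an edge of $f_i$. Each edge $e$ is incident to two faces $f_i,f_j$ (its two sides); if both sides of $e$ are the same face, both sides are counted in sums over edges of that face. Each face $f_i$ is assigned an inner radius $r_i\in(0,\frac{\pi}{2})$ and the outer radius $R_i\in(0,\frac{\pi}{2})$ with $\cos R_i=q\cos r_i$. For an edge $e$ incident to $f_i$ and $f_j$, let $O_iv_1O_jv_2$ be the spherical quadrilateral (in the unit sphere, unique up to isometry) with $\angle O_iv_1O_j=\angle O_iv_2O_j=\frac{\pi}{2}$, $|O_iv_1|=r_i$, $|O_iv_2|=R_i$, $|O_jv_1|=R_j$, $|O_jv_2|=r_j$. The geodesic segment $O_iO_j$ divides it into two right-angled triangles; $\alpha_{i,-},\alpha_{j,+}$ are the angles of $\triangle O_iv_1O_j$ at $O_i,O_j$, and $\alpha_{i,+},\alpha_{j,-}$ are the angles of $\triangle O_iv_2O_j$ at $O_i,O_j$. Put $$L_{(e,i)}=\alpha_{i,-}\cos r_i+\alpha_{i,+}\cos R_i,\qquad L_{(e,j)}=\alpha_{j,+}\cos R_j+\alpha_{j,-}\cos r_j,$$ and $L_i=\sum_{e:\,e<f_i}L_{(e,i)}$, $L=(L_1,\dots,L_{|F|})$ (the modified combinatorial total geodesic curvature). Fix $r_0\in(0,\frac{\pi}{2})$ and set $u_i=\int_{r_0}^{r_i}\frac{\mathrm{d}t}{2q\cos t\sqrt{1-q^2\cos^2t}}$,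 so that $\frac{\mathrm{d}u_i}{\mathrm{d}r_i}=\frac{1}{\sin 2R_i}>0$. The admissible space $U\subset\mathbb{R}^{|F|}$ is the set of all $u=(u_1,\dots,u_{|F|})$ arising from $(r_1,\dots,r_{|F|})\in(0,\frac{\pi}{2})^{|F|}$ (a product of open intervals), and $L$ is regarded as a function of $u\in U$. *)

(* Defs.v *)
From HB Require Import structures.
From mathcomp Require Import all_boot all_order all_algebra.
From mathcomp Require Import all_classical all_reals all_analysis.

Set Implicit Arguments.
Unset Strict Implicit.
Unset Printing Implicit Defensive.

Import Order.TTheory GRing.Theory Num.Theory.
Import numFieldNormedType.Exports.

Local Open Scope classical_set_scope.
Local Open Scope ring_scope.

(* Cellular decompositions of closed surfaces (orientable or not) are encoded
   as generalized maps.  A flag is an incident (vertex-end of an edge, edge,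
   side of that edge) triple; [a0], [a1], [a2] replace its vertex, its edge
   (turning at a corner of the face) and its face (crossing the edge)
   respectively.  Edges are the orbits of <a0, a2>, which have exactly four
   flags. *)
Record cell_decomposition := CellDecomposition {
  flag : finType;
  a0 : flag -> flag;
  a1 : flag -> flag;
  a2 : flag -> flag;
  a0K : involutive a0;
  a1K : involutive a1;
  a2K : involutive a2;
  a0_neq : forall x, a0 x != x;
  a1_neq : forall x, a1 x != x;
  a2_neq : forall x, a2 x != x;
  a02_comm : forall x, a0 (a2 x) = a2 (a0 x);
  a02_neq : forall x, a0 (a2 x) != x;
  flag_nonempty : (0 < #|flag|)%N;
  flag_connected : forall x y,
    connect (fun x y => [|| y == a0 x, y == a1 x | y == a2 x]) x y
}.

Definition orbit2 (T : finType) (f g : T -> T) (x : T) : {set T} :=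
  [set y | connect (fun x y => (y == f x) || (y == g x)) x y]%SET.

Section cells.
Variable S : cell_decomposition.

Definition face_of (x : flag S) : {set flag S} := orbit2 (@a0 S) (@a1 S) x.
Definition vertex_of (x : flag S) : {set flag S} := orbit2 (@a1 S) (@a2 S) x.

Definition faces : {set {set flag S}} := [set face_of x | x : flag S]%SET.

Definition nfaces : nat := #|faces|.

Lemma face_of_in (x : flag S) : face_of x \in faces.
Proof. exact: imset_f. Qed.

(* The faces are numbered by their enumeration order. *)
Definition face (x : flag S) : 'I_nfaces :=
  enum_rank_in (face_of_in x) (face_of x).

(* A polygon with k sides has 2k flags, and a vertex with k edge-ends has
   2k flags. *)
Definition face_degree (x : flag S) : nat := #|face_of x|./2.
Definition vertex_degree (x : flag S) : nat := #|vertex_of x|./2.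

Definition even_faces : Prop := forall x, ~~ odd (face_degree x).
Definition even_vertices : Prop := forall x, ~~ odd (vertex_degree x).

End cells.

Section sphere.
Variable R : realType.

Definition dot (x y : 'rV[R]_3) : R := \sum_k x 0 k * y 0 k.

Definition on_sphere (x : 'rV[R]_3) : Prop := dot x x = 1.

Definition sdist (x y : 'rV[R]_3) : R := acos (dot x y).

(* The component of y orthogonal to x: the initial direction at x of the
   geodesic from x to y. *)
Definition tangent (x y : 'rV[R]_3) : 'rV[R]_3 := y - dot x y *: x.

(* The spherical angle at v between the geodesics to x and to y. *)
Definition sangle (x v y : 'rV[R]_3) : R :=
  let a := tangent v x in let b := tangent v y in
  acos (dot a b / (Num.sqrt (dot a a) * Num.sqrt (dot b b))).

Definition triple (x y z : 'rV[R]_3) : R :=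
  \det (\matrix_(i < 3) [:: x; y; z]`_i : 'M[R]_3).

Record quad := Quad { Oi : 'rV[R]_3; v1 : 'rV[R]_3; Oj : 'rV[R]_3; v2 : 'rV[R]_3 }.

HB.instance Definition _ := gen_eqMixin quad.
HB.instance Definition _ := gen_choiceMixin quad.
HB.instance Definition _ := isPointed.Build quad (Quad 0 0 0 0).

(* The last condition says that v1 and v2 are on opposite sides of the great
   circle through Oi and Oj. *)
Definition is_quad (ri Ri rj Rj : R) (Q : quad) : Prop :=
  [/\ [/\ on_sphere (Oi Q), on_sphere (v1 Q), on_sphere (Oj Q)
        & on_sphere (v2 Q)],
      sangle (Oi Q) (v1 Q) (Oj Q) = pi / 2,
      sangle (Oi Q) (v2 Q) (Oj Q) = pi / 2,
      [/\ sdist (Oi Q) (v1 Q) = ri, sdist (Oi Q) (v2 Q) = Ri,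
          sdist (Oj Q) (v1 Q) = Rj & sdist (Oj Q) (v2 Q) = rj]
    & triple (Oi Q) (Oj Q) (v1 Q) * triple (Oi Q) (Oj Q) (v2 Q) < 0].

Variable q : R.

Definition outer (r : R) : R := acos (q * cos r).

(* The quadrilateral exists, and is unique up to isometry, for radii in
   ]0, pi/2[: its two triangles have the same hypotenuse, of cosine
   q * cos ri * cos rj. *)
Definition the_quad (ri rj : R) : quad :=
  get [set Q | is_quad ri (outer ri) rj (outer rj) Q].

(* [L_(e,i)] for an edge e between a face of inner radius ri and one of inner
   radius rj.  [L_(e,j)] is [edge_curvature rj ri]: exchanging (Oi, v1) with
   (Oj, v2) exchanges the two quadrilaterals. *)
Definition edge_curvature (ri rj : R) : R :=
  let Q := the_quad ri rj in
  sangle (v1 Q) (Oi Q) (Oj Q) * cos ri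
  + sangle (v2 Q) (Oi Q) (Oj Q) * cos (outer ri).

Definition oint (f : R -> R) (a b : R) : R :=
  if a <= b then \int[lebesgue_measure]_(t in `[a, b]) f t
  else - \int[lebesgue_measure]_(t in `[b, a]) f t.

Definition u_of_radius (r0 r : R) : R :=
  oint (fun t => (2 * q * cos t * Num.sqrt (1 - q ^+ 2 * cos t ^+ 2))^-1) r0 r.

(* The inverse of [u_of_radius], arbitrary outside of its range. *)
Definition radius_of_u (r0 u : R) : R :=
  get [set r | 0 < r < pi / 2 /\ u_of_radius r0 r = u].

End sphere.

Section flows.
Variables (R : realType) (S : cell_decomposition) (q r0 : R).
Notation n := (nfaces S).

(* Sum over the edge sides lying in face i.  The flags [x] and [a0 x] are the
   two flags of a same side, hence the factor 1/2; [a2 x] is across the edge.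
   An edge with both sides in face i contributes twice. *)
Definition total_curvature (r : 'I_n -> R) (i : 'I_n) : R :=
  2^-1 * \sum_(x : flag S | face x == i)
           edge_curvature q (r i) (r (face (a2 x))).

Definition admissible : set 'rV[R]_n :=
  [set u | exists r : 'I_n -> R, forall i,
     0 < r i < pi / 2 /\ u 0 i = u_of_radius q r0 (r i)].

Definition Lmap (u : 'rV[R]_n) : 'rV[R]_n :=
  \row_i total_curvature (fun j => radius_of_u q r0 (u 0 j)) i.

Definition Delta (u : 'rV[R]_n) : 'M[R]_n :=
  \matrix_(i, j) 'D_(delta_mx 0 j) (fun v => Lmap v 0 i) u.

Definition ricci_field (Lhat u : 'rV[R]_n) : 'rV[R]_n := Lmap u - Lhat.

Definition calabi_field (Lhat u : 'rV[R]_n) : 'rV[R]_n :=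
  \row_i - \sum_j Delta u i j * (Lmap u - Lhat) 0 j.

End flows.

Section ode.
Variables (R : realType) (n : nat).
Implicit Types (X : 'rV[R]_n -> 'rV[R]_n) (U : set 'rV[R]_n) (u : R -> 'rV[R]_n).

(* u solves u' = X(u) in U on the time interval [0, T[; the derivative is
   one-sided at time 0. *)
Definition is_solution X U (T : \bar R) u : Prop :=
  forall t : R, 0 <= t -> (t%:E < T)%E ->
    U (u t) /\
    (fun h => h^-1 *: (u (t + h) - u t)) @ within [set h | 0 <= t + h] 0^'
      --> X (u t).

Definition exp_converges u (a : 'rV[R]_n) : Prop :=
  exists C lambda : R, [/\ 0 < C, 0 < lambda
    & forall t, 0 <= t -> `|u t - a| <= C * expR (- lambda * t)].

(* The (necessarily unique, whence maximal) solution starting at u0 is global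
   and converges exponentially fast to a. *)
Definition solution_exp_converges X U (u0 a : 'rV[R]_n) : Prop :=
  exists u, [/\ is_solution X U +oo%E u, u 0 = u0, exp_converges u a
    & forall (T : \bar R) v, is_solution X U T v -> v 0 = u0 ->
        forall t : R, 0 <= t -> (t%:E < T)%E -> v t = u t].

End ode.

(* Main.v *)
Require Import Defs.
From HB Require Import structures.
From mathcomp Require Import all_boot all_order all_algebra.
From mathcomp Require Import all_classical all_reals all_analysis.
From mathcomp Require Import ring lra.
Import Order.TTheory GRing.Theory Num.Theory.
Import numFieldNormedType.Exports.
Local Open Scope classical_set_scope.
Local Open Scope ring_scope.

Set Implicit Arguments.
Unset Strict Implicit.
Unset Printing Implicit Defensive.

(** The main obstacle is the Calabi field, which already contains first derivatives of L:
    differentiating it in general would call for second derivatives. At a zero of L - Lhat the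
    product rule leaves only - Delta^2 and asks no more of Delta than a local Lipschitz bound, which
    its closed formula provides. Strict differentiability compares two arbitrary points near the
    zero, so one estimate at that single point yields both the Lipschitz constant for Picard
    iteration and the dissipativity inequality for pairs.

    Symmetry of Delta comes from the factor dr/du = sin 2R. To reach the explicit matrix, the angles
    of a quadrilateral known only through its defining conditions are first rewritten as arctangents
    of functions of the radii.

    Two norms coexist: the library norm on row vectors is the sup norm, while dissipativity and
    decay are Euclidean. This is where the dimension factors in the constants come from. *)

(* In the coordinates u the matrix Delta is explicit.  Along an edge with
   radii r_i, r_j put
     Q = 2 q^2 cos r_i cos r_j (sin r_i sin r_j + sin R_i sin R_j) / D,
   where D = 1 - (q cos r_i cos r_j)^2.  Then dL_(e,i)/du_j = Q is symmetric in
   i and j, and dL_(e,i)/du_i = - P, where P - Q is a positive combination of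
   A - sin A cos A over the two angles A at O_i.  Hence Delta is symmetric, and
   strictly diagonally dominant with a negative diagonal, so it is negative
   definite.  Near a zero of L - Lhat, both L - Lhat and - Delta (L - Lhat) are
   strictly differentiable with derivatives Delta and - Delta^2, so both fields
   satisfy <X u - X v, u - v> <= - c |u - v|^2; this dissipativity makes small
   balls invariant, and gives uniqueness and exponential convergence.  Global
   existence comes from Picard iteration for the field precomposed with the
   retraction onto a box. *)

(** * Real calculus *)

Section matrix_norm.
Variables (R : realType) (m n : nat).
Implicit Types x y : 'M[R]_(m, n).

Lemma mx_norm_ge x i j : `|x i j| <= `|x|.
Proof.
rewrite [leRHS]/Num.norm /= mx_normrE.
exact: (le_bigmax _ (fun ij => `|x ij.1 ij.2|) (i, j)).
Qed.

Lemma mx_norm_leP x (e : R) : 0 <= e ->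
  reflect (forall i j, `|x i j| <= e) (`|x| <= e).
Proof.
move=> e0; apply: (iffP idP) => [xe i j|xe]; first exact: le_trans (mx_norm_ge x i j) xe.
by rewrite [leLHS]/Num.norm /= mx_normrE; apply/bigmax_leP; split => // -[a b] _ /=.
Qed.

End matrix_norm.

Section row_norm.
Variables (R : realType) (n : nat).
Implicit Types x y : 'rV[R]_n.

Lemma row_norm_ge x i : `|x 0 i| <= `|x|.
Proof. exact: mx_norm_ge. Qed.

Lemma row_norm_leP x (e : R) : 0 <= e ->
  reflect (forall i, `|x 0 i| <= e) (`|x| <= e).
Proof.
move=> e0; apply: (iffP (mx_norm_leP x e0)) => H i; first exact: H.
by rewrite ord1.
Qed.

Lemma row_norm_ltP x (e : R) : 0 < e ->
  reflect (forall i, `|x 0 i| < e) (`|x| < e).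
Proof.
move=> e0; apply: (iffP idP) => [xe i|xe].
  exact: le_lt_trans (row_norm_ge x i) xe.
rewrite [ltLHS]/Num.norm /= mx_normrE; apply/bigmax_ltP; split => // -[a b] _ /=.
by rewrite ord1.
Qed.

Lemma row_norm_mulmx x (B : 'M[R]_n) : `|x *m B| <= n%:R * `|x| * `|B|.
Proof.
apply/row_norm_leP => [|j]; first by rewrite !mulr_ge0.
rewrite mxE; apply: le_trans (ler_norm_sum _ _ _) _.
have -> : n%:R * `|x| * `|B| = \sum_(k < n) `|x| * `|B|.
  by rewrite sumr_const card_ord -[RHS]mulr_natl mulrA.
by apply: ler_sum => k _; rewrite normrM ler_pM// ?row_norm_ge ?mx_norm_ge.
Qed.

Lemma rowBE x y i : (x - y) 0 i = x 0 i - y 0 i.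
Proof. by rewrite !mxE. Qed.

End row_norm.

Section real_calculus.
Variable R : realType.
Implicit Types f g : R -> R.

Lemma lipschitz_fun_continuous f K :
  (forall s t, `|f s - f t| <= K * `|s - t|) -> continuous f.
Proof.
move=> fK s; apply/cvgrPdist_lt => e e0; near=> t.
apply: le_lt_trans (fK s t) _.
have K1 : 0 < `|K| + 1 by rewrite ltr_wpDl.
apply: (@le_lt_trans _ _ ((`|K| + 1) * `|s - t|)).
  by rewrite ler_wpM2r// (le_trans (ler_norm K))// lerDl.
rewrite -ltr_pdivlMl// mulrC; near: t.
by apply: cvgr_dist_lt => //; rewrite divr_gt0.
Unshelve. all: by end_near. Qed.

Lemma is_derive_continuous f (x d : R) : is_derive x 1 f d -> {for x, continuous f}.
Proof. by case=> + _ => /derivable1_diffP/differentiable_continuous. Qed.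

Lemma MVT_segment_for f df (a b : R) : a <= b ->
  (forall x, a <= x <= b -> {for x, continuous f}) ->
  (forall x, a < x < b -> is_derive x 1 f (df x)) ->
  exists2 c, a <= c <= b & f b - f a = df c * (b - a).
Proof.
move=> ab cf dff; have cf' : {within `[a, b], continuous f}.
  by apply/continuous_in_subspaceT => x; rewrite inE/= in_itv/=; exact: cf.
have dff' x : x \in `]a, b[ -> is_derive x 1 f (df x) by rewrite in_itv/=; exact: dff.
by have [c] := MVT_segment ab dff' cf'; rewrite in_itv/=; exists c.
Qed.

Lemma MVT_for f df (a b : R) : a < b ->
  (forall x, a <= x <= b -> {for x, continuous f}) ->
  (forall x, a < x < b -> is_derive x 1 f (df x)) ->
  exists2 c, a < c < b & f b - f a = df c * (b - a).
Proof.
move=> ab cf dff; have cf' : {within `[a, b], continuous f}.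
  by apply/continuous_in_subspaceT => x; rewrite inE/= in_itv/=; exact: cf.
have dff' x : x \in `]a, b[ -> is_derive x 1 f (df x) by rewrite in_itv/=; exact: dff.
by have [c] := MVT ab dff' cf'; rewrite in_itv/=; exists c.
Qed.

(** Integrating from -1 makes 0 an interior point, so this primitive, normalized to vanish at 0, has
    a two-sided derivative at the initial time. *)
Definition primitive f (x : R) : R :=
  \int[lebesgue_measure]_(t in `[-1, x]) f t
  - \int[lebesgue_measure]_(t in `[-1, 0]) f t.

Lemma primitive0 f : primitive f 0 = 0.
Proof. exact: subrr. Qed.

Lemma is_derive_integral f (a x b : R) : a < x -> x < b ->
  (lebesgue_measure).-integrable `[a, b] (EFin \o f) -> {for x, continuous f} ->
  is_derive x 1 (fun y => \int[lebesgue_measure]_(t in `[a, y]) f t) (f x).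
Proof.
move=> ax xb intf cf; have [d1 d2] := continuous_FTC1_closed xb intf ax cf.
by apply: DeriveDef; [exact: d1|rewrite -derive1E; exact: d2].
Qed.

Lemma is_derive_primitive f (x : R) : continuous f -> -1 < x ->
  is_derive x 1 (primitive f) (f x).
Proof.
move=> cf x1; have x2 : x < x + 1 by rewrite ltrDl.
have intf : (lebesgue_measure).-integrable `[-1, x + 1] (EFin \o f).
  apply: continuous_compact_integrable; first exact: segment_compact.
  exact: continuous_subspaceT.
rewrite -[f x]subr0.
exact: (is_deriveB (is_derive_integral x1 x2 intf (cf x)) (is_derive_cst _ x (1 : R))).
Qed.

(** The mean value theorem is applied to [g - f] and to [g + f], both of which have nonnegative
    derivative. *)
Lemma derive_le_increment f g (df dg : R -> R) (t : R) : 0 <= t ->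
  (forall s, 0 <= s <= t -> is_derive s 1 f (df s)) ->
  (forall s, 0 <= s <= t -> is_derive s 1 g (dg s)) ->
  (forall s, 0 <= s <= t -> `|df s| <= dg s) ->
  `|f t - f 0| <= g t - g 0.
Proof.
move=> t0 Hf Hg le_fg.
have dB s (st : 0 <= s <= t) := is_deriveB (Hg s st) (Hf s st).
have dD s (st : 0 <= s <= t) := is_deriveD (Hg s st) (Hf s st).
have lt_le s : 0 < s < t -> 0 <= s <= t by move=> /andP[? ?]; rewrite !ltW.
have H1 : exists2 c, 0 <= c <= t &
    (g t - f t) - (g 0 - f 0) = (dg c - df c) * (t - 0).
  exact: (MVT_segment_for t0 (fun s st => is_derive_continuous (dB s st))
           (fun s st => dB s (lt_le s st))).
have H2 : exists2 c, 0 <= c <= t &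
    (g t + f t) - (g 0 + f 0) = (dg c + df c) * (t - 0).
  exact: (MVT_segment_for t0 (fun s st => is_derive_continuous (dD s st))
           (fun s st => dD s (lt_le s st))).
case: H1 => c /le_fg; rewrite ler_norml => /andP[c1 c2].
rewrite subr0 => e1.
case: H2 => b /le_fg; rewrite ler_norml => /andP[b1 b2].
rewrite subr0 => e2.
have p1 : 0 <= (dg c - df c) * t by apply: mulr_ge0 => //; lra.
have p2 : 0 <= (dg b + df b) * t by apply: mulr_ge0 => //; lra.
rewrite -e1 in p1; rewrite -e2 in p2; rewrite ler_norml; apply/andP; split; lra.
Qed.

(** With [e k] the tail of the geometric series, the intervals from [x k - e k] to [x k + e k] are
    nested; the supremum of their left ends lies in all of them. *)
Lemma geometric_sum_limit (x : nat -> R) C :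
  (forall k, `|x k.+1 - x k| <= C * 2^-1 ^+ k) ->
  exists l, forall k, `|x k - l| <= 2 * C * 2^-1 ^+ k.
Proof.
move=> xC; pose e k : R := 2 * C * 2^-1 ^+ k.
have eS k : e k.+1 = e k - C * 2^-1 ^+ k.
  by rewrite /e exprS; lra.
have C0 : 0 <= C by have := le_trans (normr_ge0 _) (xC 0%N); rewrite expr0 mulr1.
have e0 k : 0 <= e k by rewrite /e !mulr_ge0// exprn_ge0 // invr_ge0.
have ab j k : x j - e j <= x k + e k.
  have up i m : x m - e m <= x (m + i)%N - e (m + i)%N.
    elim: i => [|i ih]; first by rewrite addn0.
    rewrite addnS; apply: le_trans ih _; rewrite eS.
    have := xC (m + i)%N; rewrite ler_norml => /andP[]; lra.
  have dn i m : x (m + i)%N + e (m + i)%N <= x m + e m.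
    elim: i => [|i ih]; first by rewrite addn0.
    rewrite addnS; apply: le_trans ih; rewrite eS.
    have := xC (m + i)%N; rewrite ler_norml => /andP[]; lra.
  have [/subnKC <-|/ltnW/subnKC <-] := leqP j k.
    by apply: le_trans (up _ _) _; have := e0 (j + (k - j))%N; lra.
  by apply: le_trans (dn _ _); have := e0 (k + (j - k))%N; lra.
pose A := range (fun k => x k - e k).
have hA : has_sup A.
  by split; [exists (x 0%N - e 0%N); exists 0%N|exists (x 0%N + e 0%N) => _ [k _ <-]].
exists (sup A) => k; rewrite ler_norml lerBlDr -/(e k); apply/andP; split.
- have : sup A <= x k + e k by apply: ge_sup => [|_ [j _ <-]//]; case: hA.
  by lra.
- have : x k - e k <= sup A by apply: ub_le_sup; [case: hA|exists k].
  by lra.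
Qed.

Lemma le_geometric_lim (x y c : R) :
  (forall k : nat, x <= y + c * 2^-1 ^+ k) -> x <= y.
Proof.
move=> H; apply/ler_addgt0Pr => e e0.
have h : 0 < (`|c| + 1) by rewrite ltr_wpDl.
have /cvgrPdist_lt /(_ (e / (`|c| + 1))) : (GRing.exp (2^-1 : R)) @ \oo --> (0 : R).
  by apply: cvg_expr; rewrite ger0_norm; lra.
rewrite divr_gt0// => /(_ isT) [k _ /(_ k (leqnn k))] /=.
rewrite sub0r normrN ger0_norm; last by rewrite exprn_ge0// invr_ge0.
rewrite ltr_pdivlMr// => Hk; apply: le_trans (H k) _.
have p0 : 0 <= (2^-1 : R) ^+ k by rewrite exprn_ge0// invr_ge0.
have := ler_norm c; nra.
Qed.

(* Continuous induction: the first time at which [N] reaches an intermediate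
   level would contradict the mean value theorem. *)
Lemma sublevel_invariant (N dN : R -> R) m t1 : 0 <= t1 ->
  (forall t, 0 <= t <= t1 -> {for t, continuous N}) ->
  (forall t, 0 < t < t1 -> is_derive t 1 N (dN t)) ->
  (forall t, 0 < t < t1 -> N t < m -> dN t <= 0) ->
  N 0 < m -> N t1 <= N 0.
Proof.
move=> t10 cN dNt dN0 N0m; rewrite leNgt; apply/negP => N0t1.
(* The level must stay strictly below [m], so that the sign condition on [dN] is available at every
   time before [m'] is first reached. *)
have [m' /andP[N0m' m'm] m't1] : exists2 m', N 0 < m' < m & m' < N t1.
  exists ((N 0 + Num.min m (N t1)) / 2).
    by apply/andP; split; have [] := leP m (N t1) => ?; lra.
  by have [] := leP m (N t1) => ?; lra.
pose E := [set t | 0 <= t <= t1 /\ m' <= N t].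
have hE : has_inf E.
  by split; [exists t1; split; rewrite ?t10 ?lexx// ltW|exists 0 => t [/andP[]]].
have s0 : 0 <= inf E by apply: lb_le_inf => [|t [/andP[]]//]; case: hE.
have st1 : inf E <= t1.
  by apply: ge_inf; [case: hE|split; rewrite ?t10 ?lexx// ltW].
have ltE t : 0 <= t -> t < inf E -> N t < m'.
  move=> t0 tE; rewrite ltNge; apply/negP => Nt.
  have : inf E <= t.
    apply: ge_inf; first by case: hE.
    by split => //; rewrite t0 ltW// (lt_le_trans tE).
  by rewrite leNgt tE.
have sE : m' <= N (inf E).
  rewrite leNgt; apply/negP => sm.
  have := cN (inf E); rewrite s0 st1 => /(_ isT)/cvgrPdist_lt/(_ (m' - N (inf E))).
  rewrite subr_gt0 => /(_ sm) [d /= d0 Hd].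
  have [t Et tE] := inf_adherent d0 hE.
  have Et' : inf E <= t by apply: ge_inf => //; case: hE.
  have /Hd : ball_ (fun x => `|x|) (inf E) d t.
    by rewrite /ball_ /= ler0_norm; lra.
  case: Et => _; move: (N t) => Nt h; rewrite ltr_norml; lra.
have sgt0 : 0 < inf E.
  rewrite lt_neqAle s0 andbT; apply/eqP => e; move: sE; rewrite -e; lra.
have [||c /andP[c0 cE] e] := @MVT_for N dN 0 (inf E) sgt0.
- by move=> x /andP[x0 xE]; apply: cN; rewrite x0 (le_trans xE).
- by move=> x /andP[x0 xE]; apply: dNt; rewrite x0 (lt_le_trans xE).
have : dN c <= 0.
  apply: dN0; first by rewrite c0 (lt_le_trans cE).
  by apply: lt_trans m'm; apply: ltE => //; exact: ltW.
move: e; rewrite subr0; nra.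
Qed.

End real_calculus.

(** * Ordinary differential equations *)

Section picard.
Variables (R : realType) (n : nat) (Y : 'rV[R]_n -> 'rV[R]_n) (K M : R).
Variable u0 : 'rV[R]_n.
Hypothesis K_gt0 : 0 < K.
Hypothesis Y_lip : forall u v, `|Y u - Y v| <= K * `|u - v|.
Hypothesis Y_bnd : forall u, `|Y u| <= M.

Let lip (w : R -> 'rV[R]_n) :=
  forall s t : R, 0 <= s -> 0 <= t -> `|w s - w t| <= M * `|s - t|.

(** Reading the curve at the absolute value of time makes the integrand continuous on the whole line
    while depending only on nonnegative times. Since [Y] is bounded by [M], the iterates remain in
    the class [lip]. *)
Definition picard (w : R -> 'rV[R]_n) (t : R) : 'rV[R]_n :=
  \row_i (u0 0 i + primitive (fun s => Y (w `|s|) 0 i) t).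

Let M_ge0 : 0 <= M.
Proof. exact: le_trans (normr_ge0 _) (Y_bnd u0). Qed.

Let field_continuous w i : lip w -> continuous (fun s : R => Y (w `|s|) 0 i).
Proof.
move=> lw; apply: (@lipschitz_fun_continuous _ _ (K * M)) => s t.
have := row_norm_ge (Y (w `|s|) - Y (w `|t|)) i; rewrite rowBE => /le_trans; apply.
apply: le_trans (Y_lip _ _) _; rewrite -mulrA ler_wpM2l ?(ltW K_gt0)//.
apply: le_trans (lw `|s| `|t| (normr_ge0 _) (normr_ge0 _)) _.
by rewrite ler_wpM2l// ler_dist_dist.
Qed.

Lemma picard_derive w i (t : R) : lip w -> 0 <= t ->
  is_derive t 1 (fun s : R => picard w s 0 i) (Y (w t) 0 i).
Proof.
move=> lw t0.
have -> : (fun s => picard w s 0 i) =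
    cst (u0 0 i) + primitive (fun s => Y (w `|s|) 0 i).
  by apply/funext => s; rewrite mxE.
rewrite -[Y _ _ _]add0r; apply: is_deriveD.
have := @is_derive_primitive _ _ t (@field_continuous w i lw).
by rewrite ger0_norm//; apply; apply: lt_le_trans t0; rewrite ltrN10.
Qed.

Lemma picard0 w : picard w 0 = u0.
Proof. by apply/rowP => i; rewrite mxE primitive0 addr0. Qed.

Lemma picard_lip w : lip w -> lip (picard w).
Proof.
move=> lw s t; wlog st : s t / s <= t => [H s0 t0|s0 t0].
  by have [st|/ltW ts] := leP s t; [exact: H|rewrite distrC (distrC s); exact: H].
apply/row_norm_leP => [|i]; first by rewrite mulr_ge0.
have [||c /andP[sc _]] := @MVT_segment_for _ (fun s => picard w s 0 i)
  (fun s => Y (w s) 0 i) s t st.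
- move=> x /andP[sx _]; apply: is_derive_continuous.
  by apply: picard_derive => //; exact: le_trans sx.
- by move=> x /andP[sx _]; apply: picard_derive => //; apply: le_trans (ltW sx).
rewrite rowBE => e; rewrite distrC e normrM (distrC s).
by rewrite ler_wpM2r// (le_trans (row_norm_ge _ _)).
Qed.

Let E (t : R) := expR (2 * K * t).

Let derE (C t : R) : is_derive t 1 (fun s : R => C / 2 * E s) (K * (C * E t)).
Proof.
have -> : (fun s => C / 2 * E s) = (C / 2) *: (expR \o ( *%R (2 * K))).
  by apply/funext.
apply: is_derive_eq.
by rewrite [LHS]/GRing.scale /= /E /GRing.scale/=; lra.
Qed.

(** Bielecki's weight: the integral of K C exp(2 K s) is at most C / 2 times exp(2 K t), so a Picard
    step halves the weighted distance on the whole half-line, and no gluing of local solutions is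
    required. *)
Lemma picard_contract w w' (C : R) : lip w -> lip w' -> 0 <= C ->
  (forall t : R, 0 <= t -> `|w t - w' t| <= C * E t) ->
  forall t : R, 0 <= t -> `|picard w t - picard w' t| <= C / 2 * E t.
Proof.
move=> lw lw' C0 ww' t t0.
have E0 s : 0 <= E s by exact: expR_ge0.
apply/row_norm_leP => [|i]; first by rewrite !mulr_ge0// invr_ge0.
have := @derive_le_increment _
  ((fun s => picard w s 0 i) - (fun s => picard w' s 0 i))
  (fun s => C / 2 * E s)
  (fun s => Y (w s) 0 i - Y (w' s) 0 i) (fun s => K * (C * E s)) t t0.
rewrite !fctE !picard0 subrr subr0 rowBE => H.
apply: le_trans (H _ _ _) _.
- by move=> s /andP[s0 _]; apply: is_deriveB; exact: picard_derive.
- by move=> s _; exact: derE.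
- move=> s /andP[s0 _].
  have := row_norm_ge (Y (w s) - Y (w' s)) i; rewrite rowBE => /le_trans; apply.
  by apply: le_trans (Y_lip _ _) _; rewrite ler_wpM2l ?(ltW K_gt0)// ww'.
- by rewrite lerBlDr lerDl !mulr_ge0// invr_ge0.
Qed.

Lemma lipschitz_ode_solution : exists u : R -> 'rV[R]_n, u 0 = u0 /\
  forall (t : R) i, 0 <= t -> is_derive t 1 (fun s : R => u s 0 i) (Y (u t) 0 i).
Proof.
pose w := fix w k := if k is k'.+1 then picard (w k') else cst u0.
(* The first step moves the constant curve by at most M t = C (2 K t), which is below C exp(2 K
   t). *)
pose C := M / (2 * K).
have C0 : 0 <= C by rewrite divr_ge0// mulr_ge0// ltW.
have lw k : lip (w k).
  elim: k => [|k ih] /=; last exact: picard_lip.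
  by move=> s t _ _; rewrite subrr normr0 mulr_ge0.
have h0 k : 0 <= C * 2^-1 ^+ k by rewrite mulr_ge0// exprn_ge0 // invr_ge0.
have dw k (t : R) : 0 <= t -> `|w k.+1 t - w k t| <= C * 2^-1 ^+ k * E t.
  elim: k t => [|k ih] t t0.
    rewrite expr0 mulr1 /=.
    have := @picard_lip (cst u0) (lw 0%N) t 0 t0 (lexx 0).
    rewrite picard0 subr0 (ger0_norm t0) => /le_trans; apply.
    have -> : M * t = C * (2 * K * t) by rewrite /C; field; rewrite lt0r_neq0.
    by rewrite ler_wpM2l// (le_trans _ (expR_ge1Dx _))// lerDr.
  rewrite exprSr mulrA; exact: (picard_contract (lw k.+1) (lw k) (h0 k) ih t0).
have /choice [l Hl] (ti : R * 'I_n) : exists l, forall k, 0 <= ti.1 ->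
    `|w k ti.1 0 ti.2 - l| <= 2 * (C * E ti.1) * 2^-1 ^+ k.
  case: ti => t i /=; have [t0|tn] := leP 0 t; last by exists 0.
  have [k|l Hl] := @geometric_sum_limit _ (fun k => w k t 0 i) (C * E t); last by exists l.
  have := row_norm_ge (w k.+1 t - w k t) i; rewrite rowBE => /le_trans; apply.
  by rewrite mulrAC; exact: dw.
pose u t : 'rV[R]_n := \row_i l (t, i).
have E0 s : 0 <= E s by exact: expR_ge0.
have wu k (t : R) : 0 <= t -> `|w k t - u t| <= 2 * (C * 2^-1 ^+ k) * E t.
  move=> t0; apply/row_norm_leP => [|i]; first by apply: mulr_ge0 => //; apply: mulr_ge0.
  have -> : 2 * (C * 2^-1 ^+ k) * E t = 2 * (C * E t) * 2^-1 ^+ k by ring.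
  by rewrite rowBE [u t 0 i]mxE; exact: (Hl (t, i) k t0).
have lu : lip u.
  move=> s t s0 t0; apply: (@le_geometric_lim _ _ _ (2 * C * (E s + E t))) => k.
  have -> : u s - u t = (w k s - w k t) - (w k s - u s) + (w k t - u t).
    by apply/rowP => i; rewrite !mxE; ring.
  apply: le_trans (ler_normD _ _) _.
  apply: le_trans (lerD (ler_normB _ _) (lexx _)) _.
  have := wu k s s0; have := wu k t t0; have := lw k s t s0 t0; lra.
have pu (t : R) : 0 <= t -> picard u t = u t.
  move=> t0; apply/eqP; rewrite -subr_eq0 -normr_le0.
  apply: (@le_geometric_lim _ _ _ (2 * C * E t)) => k; rewrite add0r.
  have -> : picard u t - u t = (w k.+1 t - u t) - (picard (w k) t - picard u t).
    by apply/rowP => i; rewrite /= !mxE; ring.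
  apply: le_trans (ler_normB _ _) _.
  have := wu k.+1 t t0; rewrite exprS => h1.
  have := @picard_contract (w k) u (2 * (C * 2^-1 ^+ k)) (lw k) lu _ (wu k) t t0.
  rewrite mulr_ge0// => /(_ isT); lra.
(* The limit [u] is unspecified at negative times; [picard u] coincides with it for t >= 0 and has a
   two-sided derivative at 0 as well. *)
exists (picard u); split=> [|t i t0]; first exact: picard0.
by rewrite pu//; exact: picard_derive.
Qed.

End picard.

(** * Solutions on the half-line and componentwise derivatives *)

Section solutions.
Variables (R : realType) (n : nat).
Implicit Types (u v : R -> 'rV[R]_n) (X : 'rV[R]_n -> 'rV[R]_n) (t : R).

Lemma is_derive_epsP (f : R -> R) (x l : R) :
  is_derive x 1 f l <->
  forall e, 0 < e -> exists2 d, 0 < d &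
    forall h, h != 0 -> `|h| < d -> `|l - h^-1 * (f (x + h) - f x)| < e.
Proof.
pose q h := h^-1 *: ((f \o shift x) (h *: 1) - f x).
have qE h : q h = h^-1 * (f (x + h) - f x).
  by rewrite /q /= [h *: 1]mulr1 (addrC h).
have E : (q @ 0^' --> l) <->
  forall e, 0 < e -> exists2 d, 0 < d &
    forall h, h != 0 -> `|h| < d -> `|l - h^-1 * (f (x + h) - f x)| < e.
  split=> [/cvgrPdist_lt H e /H [d /= d0 Hd]|H].
    exists d => // h h0 hd; rewrite -qE; apply: Hd => //.
    by rewrite /ball_ /= sub0r normrN.
  apply/cvgrPdist_lt => e /H [d d0 Hd]; exists d => // h /=.
  by rewrite sub0r normrN => hd h0; rewrite qE; exact: Hd.
rewrite -E; split=> [[df <-]|H].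
  by move: df => /cvg_ex[l' H]; rewrite (_ : 'D_1 f x = l')//; exact: cvg_lim.
by apply: DeriveDef; [apply/cvg_ex; exists l|exact: cvg_lim].
Qed.

Lemma solution_quotient X U T u t : is_solution X U T u -> 0 <= t -> (t%:E < T)%E ->
  forall e, 0 < e -> exists2 d, 0 < d &
    forall h, h != 0 -> `|h| < d -> 0 <= t + h ->
      `|X (u t) - h^-1 *: (u (t + h) - u t)| < e.
Proof.
move=> su t0 tT e e0; have [_ /cvgrPdist_lt/(_ e e0) [d /= d0 Hd]] := su t t0 tT.
exists d => // h h0 hd th; apply: Hd => //.
by rewrite /ball_ /= sub0r normrN.
Qed.

(** A solution is constrained only at nonnegative times. Composing with the absolute value gives a
    function on the line with the same derivative at positive times, and, as shown next, continuous
    at 0. *)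
Lemma solution_derive X U T u t i : is_solution X U T u -> 0 < t -> (t%:E < T)%E ->
  is_derive t 1 (fun s : R => u `|s| 0 i) (X (u t) 0 i).
Proof.
move=> su t0 tT; apply/is_derive_epsP => e e0.
have [d d0 Hd] := solution_quotient su (ltW t0) tT e0.
exists (Num.min d t); first by rewrite lt_min d0.
move=> h h0; rewrite lt_min => /andP[hd]; rewrite ltr_norml => /andP[ht _].
have th : 0 <= t + h by lra.
rewrite (ger0_norm th) (gtr0_norm t0).
have := Hd h h0 hd th; apply: le_lt_trans.
by have := row_norm_ge (X (u t) - h^-1 *: (u (t + h) - u t)) i; rewrite rowBE mxE rowBE.
Qed.

Lemma solution_continuous X U T u t i : is_solution X U T u -> 0 <= t -> (t%:E < T)%E ->
  {for t, continuous (fun s : R => u `|s| 0 i)}.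
Proof.
move=> su; rewrite le_eqVlt => /predU1P[<-|t0] tT; last first.
  exact: is_derive_continuous (solution_derive i su t0 tT).
have [d d0 Hd] := solution_quotient su (lexx 0) tT ltr01.
(* Near 0 the difference quotient is within 1 of [X (u 0)], so [L] bounds the initial speed and the
   curve moves by at most [L] times the elapsed time. *)
pose L := `|X (u 0)| + 1.
have L0 : 0 < L by rewrite ltr_wpDl.
apply/cvgrPdist_lt => e e0; exists (Num.min d (e / L)).
  by rewrite /= lt_min d0 divr_gt0.
move=> s; rewrite /ball_ /= sub0r normrN lt_min => /andP[sd sL].
have [->|s0] := eqVneq s 0; first by rewrite subrr normr0.
have h0 : `|s| != 0 by rewrite normr_eq0.
have := Hd `|s| h0; rewrite normr_id add0r => /(_ sd (normr_ge0 _)) H.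
rewrite normr0 distrC -rowBE; apply: le_lt_trans (row_norm_ge _ i) _.
have -> : u `|s| - u 0 = `|s| *: (`|s|^-1 *: (u `|s| - u 0)).
  by rewrite scalerA divff// scale1r.
rewrite normrZ normr_id; set w := _ *: _ in H *.
have wL : `|w| <= L.
  have -> : w = X (u 0) - (X (u 0) - w) by rewrite opprB addrCA subrr addr0.
  by apply: le_trans (ler_normB _ _) _; rewrite lerD2l ltW.
apply: (@le_lt_trans _ _ (`|s| * L)); first by rewrite ler_wpM2l.
by rewrite -ltr_pdivlMr.
Qed.

Lemma is_solution_of_derive X U u :
  (forall t, 0 <= t -> U (u t)) ->
  (forall t i, 0 <= t -> is_derive t 1 (fun s : R => u s 0 i) (X (u t) 0 i)) ->
  is_solution X U +oo%E u.
Proof.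
move=> Uu du t t0 _; split; first exact: Uu.
apply: cvg_within_filter; apply/cvgrPdist_lt => e e0.
have /choice[d Hd] (i : 'I_n) : exists d, 0 < d /\ forall h, h != 0 -> `|h| < d ->
    `|X (u t) 0 i - h^-1 * (u (t + h) 0 i - u t 0 i)| < e.
  have [/(_ (du t i t0) e e0) [d d0 Hd] _] :=
    is_derive_epsP (fun s => u s 0 i) t (X (u t) 0 i).
  by exists d.
pose D := \big[Num.min/1]_i d i.
exists D => /=.
  by rewrite /D; elim/big_ind: _ => // [x y x0 y0|i _]; [rewrite lt_min x0|case: (Hd i)].
move=> h; rewrite /ball_ /= sub0r normrN => hD h0.
apply/row_norm_ltP => // i; rewrite rowBE 2!mxE; have [_ +] := Hd i.
rewrite [in X in _ -> X]mxE; apply => //; apply: lt_le_trans hD _.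
exact: bigmin_le_cond.
Qed.

End solutions.

(** * Exponential stability of zeros of dissipative fields *)

Section stability.
Variables (R : realType) (n : nat).
Implicit Types (x y a : 'rV[R]_n) (p q : R -> 'rV[R]_n) (X Z : 'rV[R]_n -> 'rV[R]_n).

(** The squared Euclidean norm is differentiable along curves, unlike the sup norm; it serves as
    Lyapunov function, and the comparison lemmas below carry its decay over to the sup norm. *)
Definition inner x y : R := \sum_i x 0 i * y 0 i.

Lemma inner_ge0 x : 0 <= inner x x.
Proof. by apply: sumr_ge0 => i _; rewrite -expr2 sqr_ge0. Qed.

Lemma innerZl (k : R) x y : inner (k *: x) y = k * inner x y.
Proof. by rewrite /inner mulr_sumr; apply: eq_bigr => i _; rewrite mxE mulrA. Qed.

Lemma inner_sqr_ge x i : x 0 i ^+ 2 <= inner x x.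
Proof.
rewrite /inner (bigD1 i)//= -expr2 lerDl; apply: sumr_ge0 => j _.
by rewrite -expr2 sqr_ge0.
Qed.

Lemma row_norm_le_inner x (r : R) : 0 <= r -> inner x x <= r ^+ 2 -> `|x| <= r.
Proof.
move=> r0 xr; apply/row_norm_leP => // i.
rewrite -(ger0_norm r0) -ler_sqr ?nnegrE// !real_normK ?num_real//.
exact: le_trans (inner_sqr_ge _ _) xr.
Qed.

Lemma inner_le_row_norm x : inner x x <= n%:R * `|x| ^+ 2.
Proof.
have -> : n%:R * `|x| ^+ 2 = \sum_(i < n) `|x| ^+ 2.
  by rewrite sumr_const card_ord mulr_natl.
apply: ler_sum => i _; rewrite -expr2 -real_normK ?num_real//.
by rewrite ler_sqr ?nnegrE// row_norm_ge.
Qed.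

Lemma inner_eq0 x : inner x x <= 0 -> x = 0.
Proof.
move=> x0; apply/eqP; rewrite -normr_le0; apply: row_norm_le_inner => //.
by rewrite expr0n.
Qed.

Lemma inner_derive p q (dp dq : 'rV[R]_n) (t : R) :
  (forall i, is_derive t 1 (fun s : R => p s 0 i) (dp 0 i)) ->
  (forall i, is_derive t 1 (fun s : R => q s 0 i) (dq 0 i)) ->
  is_derive t 1 (fun s : R => inner (p s - q s) (p s - q s))
    (2 * inner (dp - dq) (p t - q t)).
Proof.
move=> Hp Hq; pose f i := (fun s : R => p s 0 i) - (fun s : R => q s 0 i).
have -> : (fun s : R => inner (p s - q s) (p s - q s)) = \sum_i (f i * f i).
  apply/funext => s; rewrite fct_sumE; apply: eq_bigr => i _.
  by rewrite rowBE.
rewrite /inner mulr_sumr; apply: is_derive_sum => i.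
have fi : is_derive t 1 (f i) (dp 0 i - dq 0 i) by apply: is_deriveB.
apply: is_derive_eq; rewrite !rowBE /GRing.scale/= /f !fctE; ring.
Qed.

Definition clip (r x : R) : R := Num.max (- r) (Num.min r x).

Lemma clip_dist (r x y : R) : 0 <= r -> `|clip r x - clip r y| <= `|x - y|.
Proof.
move=> r0; wlog xy : x y / x <= y => [H|].
  by have [|/ltW] := leP x y; [exact: H|rewrite distrC (distrC x); exact: H].
rewrite (distrC x) (ger0_norm (x := y - x)) ?subr_ge0// ler_norml /clip !maxEle !minEle.
by apply/andP; split; repeat case: ifPn; rewrite -?ltNge; move=> *; lra.
Qed.

(** Clipping coordinates is 1-Lipschitz for the sup norm, so precomposing with this map turns a
    field Lipschitz on the box into a globally Lipschitz and bounded one, without changing it on the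
    box. *)
Definition box_retract a r x : 'rV[R]_n := \row_i (a 0 i + clip r (x 0 i - a 0 i)).

Lemma box_retract_dist a r x y : 0 <= r ->
  `|box_retract a r x - box_retract a r y| <= `|x - y|.
Proof.
move=> r0; apply/row_norm_leP => // i; rewrite rowBE !mxE.
rewrite opprD addrACA subrr add0r; apply: le_trans (clip_dist _ _ r0) _.
by rewrite opprB addrA subrK -rowBE row_norm_ge.
Qed.

Lemma box_retract_in a r x : 0 <= r -> `|box_retract a r x - a| <= r.
Proof.
move=> r0; apply/row_norm_leP => // i; rewrite rowBE mxE addrC addKr.
rewrite ler_norml /clip; apply/andP; split; first by rewrite le_max lexx.
by rewrite ge_max ge_min lexx; lra.
Qed.

Lemma box_retract_id a r x : `|x - a| <= r -> box_retract a r x = x.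
Proof.
move=> xr; apply/rowP => i; rewrite mxE.
have := le_trans (row_norm_ge _ i) xr; rewrite rowBE ler_norml => /andP[h1 h2].
by rewrite /clip (min_r h2) max_r// addrC subrK.
Qed.

Section field.
Variables (X : 'rV[R]_n -> 'rV[R]_n) (U : set 'rV[R]_n) (a : 'rV[R]_n).
Variables (r K c : R).
Hypothesis r_gt0 : 0 < r.
Hypothesis K_gt0 : 0 < K.
Hypothesis c_gt0 : 0 < c.
Hypothesis box_sub : forall u, `|u - a| <= r -> U u.
Hypothesis X_lip : forall u v, `|u - a| <= r -> `|v - a| <= r ->
  `|X u - X v| <= K * `|u - v|.
Hypothesis X_dissip : forall u v, `|u - a| <= r -> `|v - a| <= r ->
  inner (X u - X v) (u - v) <= - c * inner (u - v) (u - v).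
Hypothesis Xa : X a = 0.

Let N u := inner (u - a) (u - a).

Let N_box u : N u <= r ^+ 2 -> `|u - a| <= r.
Proof. exact: row_norm_le_inner (ltW r_gt0). Qed.

Let a_box : `|a - a| <= r.
Proof. by rewrite subrr normr0 ltW. Qed.

Let N_derive Z p (t : R) :
  (forall i, is_derive t 1 (fun s : R => p s 0 i) (Z (p t) 0 i)) ->
  is_derive t 1 (fun s : R => N (p s)) (2 * inner (Z (p t)) (p t - a)).
Proof.
move=> dp; rewrite -[Z (p t)]subr0; apply: (inner_derive (q := cst a)) => // i.
by rewrite mxE; exact: is_derive_cst.
Qed.

Let inner_continuous p q (t : R) :
  (forall i, {for t, continuous (fun s : R => p s 0 i)}) ->
  (forall i, {for t, continuous (fun s : R => q s 0 i)}) ->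
  {for t, continuous (fun s : R => inner (p s - q s) (p s - q s))}.
Proof.
move=> cp cq; rewrite /inner; apply: (@cvg_big _ _ +%R 0 xpredT add_continuous) => i _.
have : {for t, continuous (fun s : R => (p s - q s) 0 i)}.
  rewrite (_ : (fun s : R => _) = (fun s : R => p s 0 i - q s 0 i)); last first.
    by apply/funext => s; rewrite rowBE.
  by apply: continuousB; [exact: cp|exact: cq].
by move=> h; apply: continuousM.
Qed.

Let dissip_at u : N u <= r ^+ 2 -> inner (X u) (u - a) <= - c * N u.
Proof.
by move=> /N_box h; have := X_dissip h a_box; rewrite Xa subr0.
Qed.

(** The field [Z] agrees with [X] inside the ball only: it is the truncated field for the solution
    under construction, and [X] itself for a competing solution. Mere continuity at the endpoints
    suits a competing solution, whose derivative at time 0 is one-sided. *)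
Lemma ball_decay Z p (t1 : R) : 0 <= t1 ->
  (forall u, N u < r ^+ 2 -> Z u = X u) ->
  (forall t i, 0 <= t <= t1 -> {for t, continuous (fun s : R => p s 0 i)}) ->
  (forall t i, 0 < t < t1 -> is_derive t 1 (fun s : R => p s 0 i) (Z (p t) 0 i)) ->
  N (p 0) < r ^+ 2 ->
  N (p t1) <= N (p 0).
Proof.
move=> t10 ZX cp dp N0.
apply: (@sublevel_invariant _ (fun t => N (p t))
  (fun t => 2 * inner (Z (p t)) (p t - a)) (r ^+ 2)) => //.
- move=> t tt1; apply: inner_continuous => i; first exact: cp.
  exact: cst_continuous.
- by move=> t tt1; apply: N_derive => i; exact: dp.
- move=> t tt1 Nt; rewrite ZX//; have := dissip_at (ltW Nt).
  have : 0 <= c * N (p t) by rewrite mulr_ge0 ?inner_ge0 ?(ltW c_gt0).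
  lra.
Qed.

(** Integrating factor: by dissipativity the product of [N] along [p] and exp(2 c t) has nonpositive
    derivative as long as [p] is in the ball, where [ball_decay] confines it. *)
Lemma ball_exp_decay Z p (t1 : R) : 0 <= t1 ->
  (forall u, N u < r ^+ 2 -> Z u = X u) ->
  (forall t i, 0 <= t <= t1 -> is_derive t 1 (fun s : R => p s 0 i) (Z (p t) 0 i)) ->
  N (p 0) < r ^+ 2 ->
  N (p t1) <= N (p 0) * expR (- (2 * c) * t1).
Proof.
move=> t10 ZX dp N0.
have Nlt t : 0 <= t <= t1 -> N (p t) < r ^+ 2.
  case/andP => t0 tt1; apply: (le_lt_trans _ N0); apply: ball_decay ZX _ _ _ => //.
  - by move=> s i /andP[s0 st]; apply: (is_derive_continuous (dp _ _ _)); rewrite s0 (le_trans st).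
  - by move=> s i /andP[s0 st]; apply: dp; rewrite ltW //= (le_trans (ltW st)).
pose G := (fun t : R => N (p t)) * (expR \o *%R (2 * c)).
pose dG t := (2 * inner (Z (p t)) (p t - a) + 2 * c * N (p t)) * expR (2 * c * t).
have dGt t : 0 <= t <= t1 -> is_derive t 1 G (dG t).
  move=> tt1; have := @N_derive Z p t (fun i => dp t i tt1) => h.
  apply: is_derive_eq; rewrite /dG /GRing.scale/= /GRing.scale/=; ring.
have [||s st] := @MVT_segment_for _ G dG 0 t1 t10.
- by move=> t /dGt; exact: is_derive_continuous.
- by move=> t /andP[t0 tt1]; apply: dGt; rewrite !ltW.
have GE t : G t = N (p t) * expR (2 * c * t) by [].
rewrite subr0 !GE mulr0 expR0 mulr1 => e.
have : dG s * t1 <= 0.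
  rewrite mulr_le0_ge0// /dG mulr_le0_ge0 ?expR_ge0//.
  rewrite ZX ?Nlt//; have := dissip_at (ltW (Nlt _ st)); lra.
rewrite -e subr_le0 => h.
by rewrite mulNr expRN ler_pdivlMr ?expR_gt0.
Qed.

Theorem dissipative_exp_stable :
  exists2 V : set 'rV[R]_n, nbhs a V /\ V `<=` U &
    forall u0, V u0 -> solution_exp_converges X U u0 a.
Proof.
exists [set u | N u < r ^+ 2].
  split; last by move=> u /= /ltW/N_box; exact: box_sub.
  (* The Euclidean square is at most n times the square of the sup norm, and n / (n + 1)^2 < 1 holds
     also for n = 0. *)
  have d0 : 0 < r / n.+1%:R by rewrite divr_gt0.
  apply/nbhs_ballP; exists (r / n.+1%:R) => //= u.
  rewrite -ball_normE /= distrC => ud.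
  apply: le_lt_trans (inner_le_row_norm _) _.
  apply: (@le_lt_trans _ _ (n%:R * (r / n.+1%:R) ^+ 2)).
    by rewrite ler_wpM2l// ler_sqr ?nnegrE// ltW.
  rewrite expr_div_n mulrCA gtr_pMr ?exprn_gt0// ltr_pdivrMr ?exprn_gt0// mul1r.
  by rewrite -natrX ltr_nat expnS expn1; exact: leq_pmulr.
move=> u0 /= Nu0.
pose Y u := X (box_retract a r u).
have r0 := ltW r_gt0.
have YX u : N u < r ^+ 2 -> Y u = X u.
  by move=> /ltW/N_box h; rewrite /Y box_retract_id.
have Ylip u v : `|Y u - Y v| <= K * `|u - v|.
  apply: le_trans (X_lip _ _) _; rewrite ?box_retract_in//.
  by rewrite ler_wpM2l ?(ltW K_gt0)// box_retract_dist.
have Ybnd u : `|Y u| <= K * r.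
  rewrite -[Y u]subr0 -Xa; apply: le_trans (X_lip _ _) _; rewrite ?box_retract_in//.
  by rewrite ler_wpM2l ?(ltW K_gt0)// box_retract_in.
have [u [u00 du]] := lipschitz_ode_solution u0 K_gt0 Ylip Ybnd.
have Nu0' : N (u 0) < r ^+ 2 by rewrite u00.
have Nu (t : R) : 0 <= t -> N (u t) <= N u0 * expR (- (2 * c) * t).
  move=> t0; rewrite -u00; apply: (ball_exp_decay t0 YX) => // s i /andP[s0 _].
  exact: du.
have Nult t : 0 <= t -> N (u t) < r ^+ 2.
  move=> t0; apply: le_lt_trans (Nu t t0) _; apply: le_lt_trans Nu0.
  rewrite ler_piMr ?inner_ge0// -expR0 ler_expR mulNr oppr_le0.
  by rewrite mulr_ge0// mulr_ge0// ltW.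
have du' (t : R) i : 0 <= t -> is_derive t 1 (fun s : R => u s 0 i) (X (u t) 0 i).
  by move=> t0; rewrite -YX ?Nult//; exact: du.
exists u; split => //.
- apply: is_solution_of_derive du' => t t0.
  exact/box_sub/N_box/ltW/Nult.
(* The squared norm starts below r^2 and decays at rate 2 c; its square root gives the constants [r]
   and [c]. *)
- exists r, c; split => // t t0; apply: row_norm_le_inner.
    by rewrite mulr_ge0// expR_ge0.
  apply: le_trans (Nu t t0) _; rewrite exprMn -expRM_natl.
  apply: ler_pM => //; rewrite ?inner_ge0 ?expR_ge0 ?(ltW Nu0)//.
  by rewrite ler_expR; lra.
(* Uniqueness: a competing solution is confined to the same ball, where dissipativity for pairs
   keeps its distance to [u] from growing. *)
- move=> T v sv v0 t t0 tT.
  have ltT s : s <= t -> (s%:E < T)%E by move=> st; apply: le_lt_trans tT; rewrite lee_fin.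
  pose p (s : R) := v `|s|.
  have p0 : p 0 = u0 by rewrite /p normr0.
  have cp (s : R) i : 0 <= s <= t -> {for s, continuous (fun s : R => p s 0 i)}.
    by case/andP => s0 st; apply: solution_continuous sv s0 (ltT _ st).
  have dp (s : R) i : 0 < s <= t -> is_derive s 1 (fun s : R => p s 0 i) (X (p s) 0 i).
    case/andP => s0 st; rewrite {2}/p gtr0_norm//.
    exact: solution_derive sv s0 (ltT _ st).
  have Np s : 0 <= s <= t -> N (p s) < r ^+ 2.
    case/andP => s0 st; apply: (@le_lt_trans _ _ (N (p 0))); last by rewrite p0.
    apply: (@ball_decay X) => //; last by rewrite p0.
    + by move=> x i /andP[x0 xs]; apply: cp; rewrite x0 (le_trans xs).
    + by move=> x i /andP[x0 xs]; apply: dp; rewrite x0 (le_trans (ltW xs)).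
  have /inner_eq0/eqP : inner (p t - u t) (p t - u t) <= 0.
    have <- : inner (p 0 - u 0) (p 0 - u 0) = 0.
      by rewrite p0 u00 subrr /inner big1// => i _; rewrite mxE mul0r.
    (* Here the derivative is nonpositive at every level, so any threshold above the initial value
       serves. *)
    apply: (@sublevel_invariant _ (fun s => inner (p s - u s) (p s - u s))
       (fun s => 2 * inner (X (p s) - X (u s)) (p s - u s))
       (inner (p 0 - u 0) (p 0 - u 0) + 1)) => //.
    + move=> s st; apply: inner_continuous => i; first exact: cp.
      by case/andP: st => s0 _; exact: is_derive_continuous (du' _ _ s0).
    + move=> s /andP[s0 st]; apply: inner_derive => i; last exact/du'/ltW.
      by apply: dp; rewrite s0 ltW.
    + move=> s /andP[s0 st] _.
      have h1 : N (p s) <= r ^+ 2 by apply/ltW/Np; rewrite !ltW.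
      have := X_dissip (N_box h1) (N_box (ltW (Nult _ (ltW s0)))).
      have : 0 <= c * inner (p s - u s) (p s - u s) by rewrite mulr_ge0 ?inner_ge0 ?(ltW c_gt0).
      lra.
    + by rewrite ltrDl.
  by rewrite subr_eq0 /p ger0_norm// => /eqP.
Qed.

End field.
End stability.

(** * Spherical quadrilaterals *)

Section spherical_triangles.
Variable R : realType.
Implicit Types x y z v : 'rV[R]_3.

Lemma dot3E x y : dot x y = x 0 0 * y 0 0 + x 0 1 * y 0 1 + x 0 (2%:R) * y 0 (2%:R).
Proof.
rewrite /dot !big_ord_recl big_ord0 addr0 addrA.
by congr (_ + _ * _ + _ * _); congr (_ _ _); apply/val_inj.
Qed.

Lemma dotC x y : dot x y = dot y x.
Proof. by rewrite !dot3E; ring. Qed.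

Lemma dot_sub_scale (k l : R) x y z :
  dot (y - k *: x) (z - l *: x) =
  dot y z - l * dot x y - k * dot x z + k * l * dot x x.
Proof. by rewrite !dot3E !mxE; ring. Qed.

Lemma dot_tangent x y z : on_sphere x ->
  dot (tangent x y) (tangent x z) = dot y z - dot x y * dot x z.
Proof. by move=> x1; rewrite /tangent dot_sub_scale x1; ring. Qed.

(* Lagrange's identity: the defect is the squared norm of the cross product. *)
Lemma dot_cauchy_schwarz x y : dot x y ^+ 2 <= dot x x * dot y y.
Proof.
rewrite -subr_ge0 !dot3E.
set a := x 0 0; set b := x 0 1; set c := x 0 _.
set d := y 0 0; set e := y 0 1; set f := y 0 _.
rewrite (_ : _ - _ = (a * e - b * d) ^+ 2 + (a * f - c * d) ^+ 2 + (b * f - c * e) ^+ 2).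
  by rewrite !addr_ge0// sqr_ge0.
by ring.
Qed.

Lemma dot_sphere_itv x y : on_sphere x -> on_sphere y -> -1 <= dot x y <= 1.
Proof.
move=> x1 y1; rewrite -ler_norml -(ler_sqr (x := `|_|)) ?nnegrE//.
rewrite real_normK ?num_real// expr1n.
by have := dot_cauchy_schwarz x y; rewrite x1 y1 mulr1.
Qed.

Lemma cos_sdist x y : on_sphere x -> on_sphere y -> cos (sdist x y) = dot x y.
Proof. by move=> x1 y1; rewrite acosK// in_itv/= dot_sphere_itv. Qed.

(** Spherical Pythagoras with its converse: the tangent vectors at [v] have inner product dot x z -
    dot x v * dot z v. The direct part reads off the diagonal of a given quadrilateral, the converse
    certifies the right angles of a constructed one. *)
Lemma sangle_pihalf x v z : on_sphere x -> on_sphere v -> on_sphere z ->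
  dot x v ^+ 2 < 1 -> dot z v ^+ 2 < 1 ->
  sangle x v z = pi / 2 <-> dot x z = dot x v * dot z v.
Proof.
move=> x1 v1 z1 xv zv.
set a := tangent v x; set b := tangent v z.
have aE : dot a a = 1 - dot x v ^+ 2.
  by rewrite /a dot_tangent// x1 (dotC v); ring.
have bE : dot b b = 1 - dot z v ^+ 2.
  by rewrite /b dot_tangent// z1 (dotC v); ring.
have abE : dot a b = dot x z - dot x v * dot z v.
  by rewrite /a /b dot_tangent// !(dotC v).
have a0 : 0 < dot a a by rewrite aE subr_gt0.
have b0 : 0 < dot b b by rewrite bE subr_gt0.
have d0 : 0 < Num.sqrt (dot a a) * Num.sqrt (dot b b).
  by rewrite mulr_gt0// sqrtr_gt0.
rewrite /sangle -/a -/b; split=> [H|H]; last first.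
  by rewrite abE H subrr mul0r acos0.
suff : dot a b = 0 by rewrite abE => /eqP; rewrite subr_eq0 => /eqP.
have : cos (pi / 2) = dot a b / (Num.sqrt (dot a a) * Num.sqrt (dot b b)).
  rewrite -H acosK// in_itv/= -ler_norml normrM normfV (gtr0_norm d0).
  rewrite ler_pdivrMr// mul1r -(ler_sqr (x := `|_|)) ?nnegrE ?(ltW d0)//.
  rewrite real_normK ?num_real// exprMn !sqr_sqrtr ?(ltW a0) ?(ltW b0)//.
  exact: dot_cauchy_schwarz.
rewrite cos_pihalf => /esym/eqP; rewrite mulf_eq0 invr_eq0 (gt_eqF d0) orbF.
by move/eqP.
Qed.

Lemma right_triangle_angle x v z : on_sphere x -> on_sphere v -> on_sphere z ->
  dot x v ^+ 2 < 1 -> dot z v ^+ 2 < 1 -> sangle x v z = pi / 2 ->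
  sangle v x z = acos (Num.sqrt (1 - dot x v ^+ 2) * dot z v
                       / Num.sqrt (1 - (dot x v * dot z v) ^+ 2)).
Proof.
move=> x1 v1 z1 xv zv; rewrite sangle_pihalf// => xz.
rewrite /sangle !dot_tangent// v1 z1 xz; congr acos.
rewrite (dotC v z); set a := dot x v in xv *; set b := dot z v.
have -> : b - a * (a * b) = (1 - a ^+ 2) * b by ring.
have -> : 1 - a * a = 1 - a ^+ 2 by ring.
have -> : 1 - a * b * (a * b) = 1 - (a * b) ^+ 2 by ring.
have s0 : 0 < Num.sqrt (1 - a ^+ 2) by rewrite sqrtr_gt0 subr_gt0.
rewrite -{1}(@sqr_sqrtr _ (1 - a ^+ 2)) ?subr_ge0 ?(ltW xv)//.
rewrite expr2 invfM mulrACA -!mulrA; congr (_ * _).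
by rewrite mulrCA [RHS]mulrC; rewrite !mulrA mulVf ?mul1r ?gt_eqF// mulrC.
Qed.

(** Napier's rule tan A = tan b / sin a, for legs a adjacent and b opposite to the angle A. The
    arctangent is the form that gets differentiated. *)
Lemma acos_atan (ca sa cb sb : R) : 0 < sa -> 0 < cb -> 0 < sb ->
  sa ^+ 2 = 1 - ca ^+ 2 -> sb ^+ 2 = 1 - cb ^+ 2 ->
  acos (sa * cb / Num.sqrt (1 - (ca * cb) ^+ 2)) = atan (sb / (cb * sa)).
Proof.
move=> sa0 cb0 sb0 Ha Hb.
have p0 : 0 < cb * sa by rewrite mulr_gt0.
have -> : sa * cb / Num.sqrt (1 - (ca * cb) ^+ 2) = cos (atan (sb / (cb * sa))).
  rewrite cos_atan.
  have -> : 1 + (sb / (cb * sa)) ^+ 2 = (1 - (ca * cb) ^+ 2) / (cb * sa) ^+ 2.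
    rewrite exprMn exprVn -{1}(divff (x := (cb * sa) ^+ 2)) ?gt_eqF ?exprn_gt0//.
    rewrite -mulrDl; congr (_ / _).
    by rewrite !exprMn Ha Hb; ring.
  rewrite sqrtrM; last first.
    have -> : 1 - (ca * cb) ^+ 2 = sa ^+ 2 * cb ^+ 2 + sb ^+ 2.
      by rewrite exprMn Ha Hb; ring.
    by apply: addr_ge0; [apply: mulr_ge0|]; exact: sqr_ge0.
  rewrite sqrtrV ?sqr_ge0// sqrtr_sqr gtr0_norm// invfM invrK mulrC.
  by rewrite (mulrC sa).
have a0 : 0 < atan (sb / (cb * sa)).
  by rewrite -atan0 lt_atan// divr_gt0.
rewrite cosK// in_itv/= (ltW a0)/=.
by apply: le_trans (ltW (atan_ltpi2 _)) _; have := @pi_ge0 R; lra.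
Qed.

Definition row3 (a b c : R) : 'rV[R]_3 := \row_(j < 3) [:: a; b; c]`_j.

Lemma dot_row3 (a b c a' b' c' : R) :
  dot (row3 a b c) (row3 a' b' c') = a * a' + b * b' + c * c'.
Proof. by rewrite dot3E !mxE. Qed.

Lemma triple_row3 (c s x y z : R) :
  triple (row3 1 0 0) (row3 c s 0) (row3 x y z) = s * z.
Proof.
rewrite /triple det_trig; last first.
  apply/is_trig_mxP => -[[|[|[|i]]] Hi] // [[|[|[|j]]] Hj] // _; by rewrite !mxE.
by rewrite !big_ord_recl big_ord0 !mxE /= mul1r mulr1.
Qed.

(** The hypotenuse is laid in the plane of the first two axes, from (1, 0, 0) to (ca cb, s, 0). The
    inner products with its ends force two coordinates of the vertex and unit length the third up to
    sign; [sa] may be negative, which selects the side. *)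
Lemma right_triangle_vertex (ca sa cb sb s : R) : s != 0 ->
  sa ^+ 2 = 1 - ca ^+ 2 -> sb ^+ 2 = 1 - cb ^+ 2 -> s ^+ 2 = 1 - (ca * cb) ^+ 2 ->
  let v := row3 ca (sa ^+ 2 * cb / s) (sa * sb / s) in
  [/\ dot v v = 1, dot (row3 1 0 0) v = ca & dot (row3 (ca * cb) s 0) v = cb].
Proof.
move=> s0 Ha Hb Hs /=; rewrite !dot_row3; split.
- have -> : ca * ca + sa ^+ 2 * cb / s * (sa ^+ 2 * cb / s) + sa * sb / s * (sa * sb / s)
     = ca ^+ 2 + sa ^+ 2 * (sa ^+ 2 * cb ^+ 2 + sb ^+ 2) / s ^+ 2 by field.
  have -> : sa ^+ 2 * cb ^+ 2 + sb ^+ 2 = s ^+ 2 by rewrite Ha Hb Hs; ring.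
  by rewrite mulfK ?expf_neq0// Ha; ring.
- by ring.
- have -> : ca * cb * ca + s * (sa ^+ 2 * cb / s) + 0 * (sa * sb / s) =
    (ca ^+ 2 + sa ^+ 2) * cb by field.
  by rewrite Ha; ring.
Qed.

(** * Existence of the quadrilateral and a closed formula for the edge curvature *)

Section curvature.
Variable q : R.
Hypothesis q01 : 0 < q <= 1.

Definition sin_outer (r : R) : R := Num.sqrt (1 - (q * cos r) ^+ 2).

Lemma cos_gt0_acute (r : R) : 0 < r < pi / 2 -> 0 < cos r.
Proof. by move=> r0; apply: cos_gt0_pihalf; lra. Qed.

Lemma cos_sqr_lt1 (r : R) : 0 < r < pi / 2 -> cos r ^+ 2 < 1.
Proof.
by move=> r0; have := sin_gt0_pihalf r0; rewrite cos2sin2; nra.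
Qed.

Lemma outer_cos_gt0 (r : R) : 0 < r < pi / 2 -> 0 < q * cos r.
Proof. by move=> /cos_gt0_acute c; case/andP: q01 => q0 _; rewrite mulr_gt0. Qed.

Lemma outer_cos_sqr_lt1 (r : R) : 0 < r < pi / 2 -> (q * cos r) ^+ 2 < 1.
Proof.
move=> r0; have := cos_sqr_lt1 r0; case/andP: q01 => q0 q1; rewrite exprMn.
apply: le_lt_trans; rewrite ler_piMl ?sqr_ge0//; nra.
Qed.

Lemma sin_outer_gt0 (r : R) : 0 < r < pi / 2 -> 0 < sin_outer r.
Proof. by move=> r0; rewrite sqrtr_gt0 subr_gt0 outer_cos_sqr_lt1. Qed.

Lemma sin_outer_sqr (r : R) : 0 < r < pi / 2 -> sin_outer r ^+ 2 = 1 - (q * cos r) ^+ 2.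
Proof. by move=> r0; rewrite sqr_sqrtr// subr_ge0 ltW// outer_cos_sqr_lt1. Qed.

Lemma cos_outer (r : R) : 0 < r < pi / 2 -> cos (outer q r) = q * cos r.
Proof.
move=> r0; rewrite acosK// in_itv/= -ler_norml -(ler_sqr (x := `|_|)) ?nnegrE//.
by rewrite real_normK ?num_real// expr1n ltW// outer_cos_sqr_lt1.
Qed.

(** The two right triangles fit along a common hypotenuse because cos r_i cos R_j = cos R_i cos r_j
    = q cos r_i cos r_j. Existence is what makes the choice in [the_quad] satisfy its
    specification. *)
Lemma quad_exists (ri rj : R) : 0 < ri < pi / 2 -> 0 < rj < pi / 2 ->
  exists Q, is_quad ri (outer q ri) rj (outer q rj) Q.
Proof.
move=> i0 j0.
have [si sj] := (sin_gt0_pihalf i0, sin_gt0_pihalf j0).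
have [Si Sj] := (sin_outer_gt0 i0, sin_outer_gt0 j0).
have acosk r : 0 < r < pi / 2 -> acos (cos r) = r.
  by move=> r0; rewrite cosK// in_itv/=; lra.
pose h := cos ri * (q * cos rj); pose s := Num.sqrt (1 - h ^+ 2).
have h1 : h ^+ 2 < 1.
  rewrite exprMn; apply: le_lt_trans (outer_cos_sqr_lt1 j0).
  by rewrite ler_piMl ?sqr_ge0// ltW// cos_sqr_lt1.
have s0 : 0 < s by rewrite sqrtr_gt0 subr_gt0.
have s2 : s ^+ 2 = 1 - h ^+ 2 by rewrite sqr_sqrtr// subr_ge0 ltW.
have hE : q * cos ri * cos rj = h by rewrite /h; ring.
pose O := row3 1 0 0; pose P := row3 h s 0.
have O1 : on_sphere O by rewrite /on_sphere dot_row3; ring.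
have P1 : on_sphere P by rewrite /on_sphere dot_row3 -!expr2 s2; ring.
have OP : dot O P = h by rewrite dot_row3; ring.
have [] := @right_triangle_vertex (cos ri) (sin ri) (q * cos rj) (sin_outer rj) s.
  by rewrite gt_eqF.
  by rewrite sin2cos2.
  exact: sin_outer_sqr.
  by rewrite s2.
set v := row3 _ _ _; rewrite -/O -/h -/P => v1 Ov Pv.
(* The negative sine puts the fourth vertex on the other side of the diagonal. *)
have [] := @right_triangle_vertex (q * cos ri) (- sin_outer ri) (cos rj) (sin rj) s.
  by rewrite gt_eqF.
  by rewrite sqrrN sin_outer_sqr.
  by rewrite sin2cos2.
  by rewrite hE.
set w := row3 _ _ _; rewrite -/O hE -/P => w1 Ow Pw.
exists (Quad O v P w); split => //=.
- apply/sangle_pihalf => //; rewrite ?Ov ?Pv ?OP//.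
    exact: cos_sqr_lt1.
  exact: outer_cos_sqr_lt1.
- apply/sangle_pihalf => //; rewrite ?Ow ?Pw ?OP ?hE//.
    exact: outer_cos_sqr_lt1.
  exact: cos_sqr_lt1.
- by rewrite /sdist Ov Ow Pv Pw !acosk.
- rewrite !triple_row3 (_ : _ * _ = - (sin ri * sin_outer rj * sin_outer ri * sin rj)).
    by rewrite oppr_lt0 !mulr_gt0.
  by field; rewrite gt_eqF.
Qed.

(** The side lengths and right angles determine the angles at [Oi], so the value does not depend on
    which quadrilateral [get] selects. *)
Lemma edge_curvatureE (ri rj : R) : 0 < ri < pi / 2 -> 0 < rj < pi / 2 ->
  edge_curvature q ri rj =
  atan (sin_outer rj / (q * cos rj * sin ri)) * cos ri
  + atan (sin rj / (cos rj * sin_outer ri)) * (q * cos ri).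
Proof.
move=> i0 j0; rewrite /edge_curvature /the_quad; set Q := get _.
have [ [sOi sv1 sOj sv2] a1' a2' [dOv dOw dPv dPw] _] : is_quad ri (outer q ri) rj (outer q rj) Q.
  by have [Q' HQ'] := quad_exists i0 j0; exact: (getI HQ').
have Ov : dot (Oi Q) (v1 Q) = cos ri by rewrite -cos_sdist// dOv.
have Ow : dot (Oi Q) (v2 Q) = q * cos ri by rewrite -cos_sdist// dOw cos_outer.
have Pv : dot (Oj Q) (v1 Q) = q * cos rj by rewrite -cos_sdist// dPv cos_outer.
have Pw : dot (Oj Q) (v2 Q) = cos rj by rewrite -cos_sdist// dPw.
rewrite cos_outer//; congr (_ * _ + _ * _).
- rewrite right_triangle_angle// ?Ov ?Pv ?cos_sqr_lt1 ?outer_cos_sqr_lt1//.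
  rewrite -sin2cos2 sqrtr_sqr gtr0_norm ?sin_gt0_pihalf//.
  apply: acos_atan; rewrite ?sin_gt0_pihalf ?sin_outer_gt0 ?outer_cos_gt0//.
    exact: sin2cos2.
  exact: sin_outer_sqr.
- rewrite right_triangle_angle// ?Ow ?Pw ?cos_sqr_lt1 ?outer_cos_sqr_lt1//.
  apply: acos_atan; rewrite ?sin_gt0_pihalf ?sin_outer_gt0 ?cos_gt0_acute//.
    exact: sin_outer_sqr.
  exact: sin2cos2.
Qed.

End curvature.
End spherical_triangles.

(** * Locally Lipschitz functions *)

Section local_lipschitz.
Variable R : realType.

(** The bound concerns all pairs near [a], as Picard iteration and the product rule for strict
    derivatives require; it is stable under sums, products and composition, so it passes to the
    explicit Jacobian entries. *)
Definition loc_lip (V W : normedModType R) (F : V -> W) (a : V) : Prop :=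
  exists K d : R, [/\ 0 <= K, 0 < d & forall u v, `|u - a| < d -> `|v - a| < d ->
    `|F u - F v| <= K * `|u - v|].

Section vectors.
Variables V W : normedModType R.
Implicit Types a : V.

Lemma loc_lip_near (F : V -> W) a : loc_lip F a -> forall e : R, 0 < e ->
  exists2 d : R, 0 < d & forall u, `|u - a| < d -> `|F u - F a| < e.
Proof.
move=> [K [d [K0 d0 H]]] e e0.
have K1 : 0 < K + 1 by rewrite ltr_wpDl.
exists (Num.min d (e / (K + 1))); first by rewrite lt_min d0 divr_gt0.
move=> u; rewrite lt_min ltr_pdivlMr// => /andP[ud ue].
apply: le_lt_trans (H u a ud _) _; first by rewrite subrr normr0.
by apply: le_lt_trans ue; rewrite mulrC ler_wpM2l// lerDl.
Qed.

Lemma loc_lip_eq (F G : V -> W) a (d : R) : 0 < d ->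
  (forall u, `|u - a| < d -> F u = G u) -> loc_lip F a -> loc_lip G a.
Proof.
move=> d0 FG [K [d' [K0 d'0 H]]].
exists K, (Num.min d d'); split=> [//||u v]; first by rewrite lt_min d0.
by rewrite !lt_min => /andP[ud ud'] /andP[vd vd']; rewrite -!FG//; exact: H.
Qed.

End vectors.

Section scalars.
Variable V : normedModType R.
Implicit Types (F G : V -> R) (a : V).

Lemma loc_lip_cst (k : R) a : loc_lip (fun=> k) a.
Proof. by exists 0, 1; split=> // u v _ _; rewrite subrr normr0 mul0r. Qed.

Lemma loc_lipD F G a : loc_lip F a -> loc_lip G a -> loc_lip (fun u => F u + G u) a.
Proof.
move=> [K [d [K0 d0 HF]]] [L [e [L0 e0 HG]]].
exists (K + L), (Num.min d e); split; rewrite ?addr_ge0// ?lt_min ?d0//.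
move=> u v; rewrite !lt_min => /andP[ud ue] /andP[vd ve].
rewrite opprD addrACA mulrDl; apply: le_trans (ler_normD _ _) _.
by rewrite lerD ?HF ?HG.
Qed.

Lemma loc_lipN F a : loc_lip F a -> loc_lip (fun u => - F u) a.
Proof.
move=> [K [d [K0 d0 H]]]; exists K, d; split=> // u v ud vd.
by rewrite -opprD normrN; exact: H.
Qed.

Lemma loc_lipM F G a : loc_lip F a -> loc_lip G a -> loc_lip (fun u => F u * G u) a.
Proof.
move=> lF lG.
have [d1 d10 H1] := loc_lip_near lF ltr01.
have [d2 d20 H2] := loc_lip_near lG ltr01.
case: lF => K [d [K0 d0 HF]]; case: lG => L [e [L0 e0 HG]].
exists ((`|F a| + 1) * L + K * (`|G a| + 1)), (Num.min (Num.min d e) (Num.min d1 d2)).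
split; first by rewrite addr_ge0// mulr_ge0// addr_ge0.
  by rewrite !lt_min d0 e0 d10.
move=> u v; rewrite !lt_min => /andP[/andP[ud ue] /andP[u1 u2]].
move=> /andP[/andP[vd ve] /andP[v1 v2]].
have -> : F u * G u - F v * G v = F u * (G u - G v) + (F u - F v) * G v by ring.
apply: le_trans (ler_normD _ _) _; rewrite [leRHS]mulrDl !normrM.
have bF : `|F u| <= `|F a| + 1.
  rewrite -[F u](subrK (F a)) addrC; apply: le_trans (ler_normD _ _) _.
  by rewrite lerD2l ltW// H1.
have bG : `|G v| <= `|G a| + 1.
  rewrite -[G v](subrK (G a)) addrC; apply: le_trans (ler_normD _ _) _.
  by rewrite lerD2l ltW// H2.
apply: lerD.
  by rewrite -mulrA ler_pM// HG.
by rewrite mulrAC ler_pM// HF.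
Qed.

Lemma loc_lip_sum (I : Type) (s : seq I) (P : pred I) (F : I -> V -> R) a :
  (forall i, loc_lip (F i) a) -> loc_lip (fun u => \sum_(i <- s | P i) F i u) a.
Proof.
move=> lF; elim: s => [|i s ih].
  rewrite (_ : (fun _ => _) = fun=> 0); first exact: loc_lip_cst.
  by apply/funext => u; rewrite big_nil.
rewrite (_ : (fun _ => _) =
  fun u => (if P i then F i u else 0) + \sum_(j <- s | P j) F j u); last first.
  by apply/funext => u; rewrite big_cons; case: ifP => // _; rewrite add0r.
by apply: loc_lipD => //; case: (P i); [exact: lF|exact: loc_lip_cst].
Qed.

End scalars.

Lemma loc_lip_comp (V W Z : normedModType R) (f : W -> Z) (F : V -> W) (a : V) :
  loc_lip f (F a) -> loc_lip F a -> loc_lip (fun u => f (F u)) a.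
Proof.
move=> [K [d [K0 d0 Hf]]] lF; have [d1 d10 H1] := loc_lip_near lF d0.
case: lF => L [e [L0 e0 HF]].
exists (K * L), (Num.min e d1); split; rewrite ?mulr_ge0// ?lt_min ?e0//.
move=> u v; rewrite !lt_min => /andP[ue u1] /andP[ve v1].
apply: le_trans (Hf _ _ (H1 _ u1) (H1 _ v1)) _.
by rewrite -mulrA ler_wpM2l// HF.
Qed.

Lemma loc_lip_derive (f f' : R -> R) (x d : R) : 0 < d ->
  (forall y, `|y - x| < d -> is_derive y 1 f (f' y)) ->
  {for x, continuous f'} -> loc_lip f x.
Proof.
move=> d0 df /cvgrPdist_lt/(_ 1 ltr01)[e /= e0 He].
exists (`|f' x| + 1), (Num.min d e); split; first by rewrite addr_ge0.
  by rewrite lt_min d0.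
move=> u v; wlog uv : u v / v <= u => [H ud vd|].
  by have [vu|/ltW uv] := leP v u; [exact: H|rewrite distrC (distrC u); exact: H].
rewrite !lt_min !ltr_norml => /andP[/andP[u1 u2] /andP[u3 u4]].
move=> /andP[/andP[v1 v2] /andP[v3 v4]].
have [|y|y y_uv] := @MVT_segment_for _ f f' v u uv.
- by move=> y y_uv; apply: (is_derive_continuous (df y _)); rewrite ltr_norml; lra.
- by move=> y_uv; apply: df; rewrite ltr_norml; lra.
move=> ->; rewrite normrM ler_wpM2r//.
rewrite -[f' y](subrK (f' x)) addrC; apply: le_trans (ler_normD _ _) _.
rewrite lerD2l distrC ltW//; apply: He.
by rewrite /ball_ /= ltr_norml; lra.
Qed.

End local_lipschitz.

Section derivative_rules.
Variable R : realType.
Implicit Types (f g : R -> R) (x : R).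

Lemma is_derive_mul f g x (df dg : R) :
  is_derive x 1 f df -> is_derive x 1 g dg ->
  is_derive x 1 (fun y => f y * g y) (df * g x + f x * dg).
Proof.
move=> Hf Hg; have := is_deriveM Hf Hg => H; apply: (is_derive_eq H).
by rewrite /GRing.scale/= addrC (mulrC df).
Qed.

Lemma is_derive_cmul (k : R) f x (df : R) :
  is_derive x 1 f df -> is_derive x 1 (fun y => k * f y) (k * df).
Proof. by move=> Hf; exact: (is_deriveZ k Hf). Qed.

Lemma is_derive_inv f x (df : R) : f x != 0 ->
  is_derive x 1 f df -> is_derive x 1 (fun y => (f y)^-1) (- (f x) ^- 2 * df).
Proof. by move=> f0 Hf; exact: (is_deriveV f0 Hf). Qed.

(** The derivative of the polar angle of (g, f). For both angles of an edge the sum of squares below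
    becomes [hyp_sin2]. *)
Lemma is_derive_atan_div f g x (df dg : R) : g x != 0 ->
  is_derive x 1 f df -> is_derive x 1 g dg ->
  is_derive x 1 (fun y => atan (f y / g y))
    ((df * g x - f x * dg) / (f x ^+ 2 + g x ^+ 2)).
Proof.
move=> g0 Hf Hg; have H := is_derive_mul Hf (is_derive_inv g0 Hg).
have H2 := @is_derive1_comp _ (@atan R) _ x _ _ (is_derive1_atan _) H.
apply: (is_derive_eq H2).
have p : 0 < g x ^+ 2 by rewrite exprn_even_gt0.
have p2 : f x ^+ 2 + g x ^+ 2 != 0 by rewrite gt_eqF// ltr_wpDl// sqr_ge0.
have p3 : 1 + (f x / g x) ^+ 2 != 0 by rewrite gt_eqF// ltr_pwDl// sqr_ge0.
by field; rewrite g0 p2.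
Qed.

(** With A = atan (a / b) the left side is sin A cos A, so this is sin 2A < 2A. The difference atan
    y - y / (1 + y^2) vanishes at 0 and has derivative 2 y^2 / (1 + y^2)^2. *)
Lemma atan_div_gt (a b : R) : 0 < a -> 0 < b -> a * b / (a ^+ 2 + b ^+ 2) < atan (a / b).
Proof.
move=> a0 b0; pose z := a / b.
have z0 : 0 < z by rewrite divr_gt0.
have -> : a * b / (a ^+ 2 + b ^+ 2) = z / (1 + z ^+ 2).
  have p2 : a ^+ 2 + b ^+ 2 != 0 by rewrite gt_eqF// addr_gt0 ?exprn_gt0.
  have p3 : 1 + (a / b) ^+ 2 != 0 by rewrite gt_eqF// ltr_pwDl// sqr_ge0.
  by rewrite /z; field; apply/andP; split; rewrite ?(gt_eqF b0)// addrC.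
pose f := (@atan R) - (fun y : R => y * (1 + y ^+ 2)^-1).
pose df (y : R) := 2 * y ^+ 2 / (1 + y ^+ 2) ^+ 2.
have p (y : R) : 0 < 1 + y ^+ 2 by rewrite ltr_pwDl// sqr_ge0.
have Hf (y : R) : is_derive y 1 f (df y).
  have h0 := is_deriveD (is_derive_cst (1 : R) y (1 : R)) (is_deriveX 2 (is_derive_id y (1 : R))).
  have h1 : is_derive y 1 (fun y : R => 1 + y ^+ 2) (2 * y).
    by apply: (is_derive_eq h0); rewrite /GRing.scale/= add0r mulr1 expr1.
  have h2 := is_derive_inv (f := fun y : R => 1 + y ^+ 2) (lt0r_neq0 (p y)) h1.
  have h3 := is_derive_mul (is_derive_id y (1 : R)) h2.
  have h4 := is_deriveB (is_derive1_atan y) h3.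
  apply: (is_derive_eq h4); rewrite /df.
  by field; rewrite gt_eqF.
have cf y : {for y, continuous f} by exact: is_derive_continuous (Hf y).
have [c /andP[c0 _]] := MVT_for z0 (fun y _ => cf y) (fun y _ => Hf y).
rewrite /f !fctE atan0 mul0r !subr0 => e.
rewrite -subr_gt0 e mulr_gt0// /df divr_gt0 ?exprn_gt0//.
by rewrite mulr_gt0// exprn_gt0.
Qed.

End derivative_rules.

(** * Radii as functions of u *)

Section radii.
Variables (R : realType) (q r0 : R).
Hypothesis q01 : 0 < q <= 1.
Hypothesis r0_acute : 0 < r0 < pi / 2.
Implicit Types (r s : R).

Lemma acute_open r : 0 < r < pi / 2 -> exists2 d : R, 0 < d &
  forall y, `|y - r| < d -> 0 < y < pi / 2.
Proof.
move=> r01; exists (Num.min r (pi / 2 - r)); first by rewrite lt_min; lra.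
by move=> y; rewrite lt_min !ltr_norml; lra.
Qed.

Lemma sin_outer_derive r : 0 < r < pi / 2 ->
  is_derive r 1 (sin_outer q) (q ^+ 2 * cos r * sin r / sin_outer q r).
Proof.
move=> r01; have h1 := is_derive_cmul q (is_derive_cos r).
have h2 := is_deriveB (is_derive_cst (1 : R) r (1 : R)) (is_derive_mul h1 h1).
have p : 0 < 1 - q * cos r * (q * cos r).
  by rewrite subr_gt0 -expr2 outer_cos_sqr_lt1.
have h3 := @is_derive1_comp _ Num.sqrt _ r _ _ (is_derive1_sqrt p) h2.
have -> : sin_outer q = Num.sqrt \o (cst 1 - (fun y => q * cos y * (q * cos y))).
  by apply/funext => y /=; rewrite /sin_outer expr2.
apply: (is_derive_eq h3); rewrite !fctE -expr2 -/(sin_outer q r).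
by field; rewrite gt_eqF// sin_outer_gt0.
Qed.

(* The derivative [sin (2 R)] of the radius with respect to [u]. *)
Definition radius_speed r : R := 2 * (q * cos r) * sin_outer q r.

Lemma radius_speed_gt0 r : 0 < r < pi / 2 -> 0 < radius_speed r.
Proof.
by move=> r01; rewrite !mulr_gt0 ?sin_outer_gt0 ?cos_gt0_acute//; case/andP: q01.
Qed.

Lemma continuous_radius_speed r : 0 < r < pi / 2 -> {for r, continuous radius_speed}.
Proof.
move=> r01.
have h1 := is_derive_cmul 2 (is_derive_cmul q (is_derive_cos r)).
exact: is_derive_continuous (is_derive_mul h1 (sin_outer_derive r01)).
Qed.

Let f t : R := (2 * q * cos t * Num.sqrt (1 - q ^+ 2 * cos t ^+ 2))^-1.

Let fE : f = fun t => (radius_speed t)^-1.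
Proof.
by apply/funext => t; rewrite /f /radius_speed /sin_outer exprMn mulrA.
Qed.

Let f_continuous r : 0 < r < pi / 2 -> {for r, continuous f}.
Proof.
move=> r01; rewrite fE; apply: continuousV; first by rewrite gt_eqF// radius_speed_gt0.
exact: continuous_radius_speed.
Qed.

Let f_integrable (a b : R) : 0 < a -> b < pi / 2 ->
  (lebesgue_measure).-integrable `[a, b] (EFin \o f).
Proof.
move=> a0 b1; apply: continuous_compact_integrable; first exact: segment_compact.
apply/continuous_in_subspaceT => x; rewrite inE/= in_itv/= => /andP[ax xb].
by apply: f_continuous; rewrite (lt_le_trans a0)// (le_lt_trans xb).
Qed.

Lemma u_of_radius_derive r : 0 < r < pi / 2 ->
  is_derive r 1 (u_of_radius q r0) (radius_speed r)^-1.
Proof.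
(* These bracket both [r] and [r0] inside the open interval, where the integrand is continuous; near
   [r] the oriented integral is then [F y - F r0] on either side of [r0]. *)
move=> r01; pose a := Num.min r r0 / 2; pose b := (Num.max r r0 + pi / 2) / 2.
have [/andP[r_gt0 r_lt] /andP[r0_gt0 r0_lt]] := (r01, r0_acute).
have [a0 ar ar0] : [/\ 0 < a, a < r & a < r0].
  by rewrite /a; have [h|h] := leP r r0; clear b; split; lra.
have [b1 rb r0b] : [/\ b < pi / 2, r < b & r0 < b].
  by rewrite /b; have [h|h] := leP r r0; clear a a0 ar ar0; split; lra.
have intf := f_integrable a0 b1.
pose F y := \int[lebesgue_measure]_(t in `[a, y]) f t.
have split_int x y : a <= x -> x <= y -> y < pi / 2 ->
    \int[lebesgue_measure]_(t in `[x, y]) f t = F y - F x.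
  move=> ax xy y1; rewrite /F Rintegral_itvB; last 3 first.
  - exact: f_integrable.
  - by rewrite bnd_simp.
  - by rewrite bnd_simp.
  rewrite Rintegral_itv_obnd_cbnd//.
  apply: integrableS (f_integrable (lt_le_trans a0 ax) y1) => //.
  exact: subset_itv_oc_cc.
have uE : \near r, (F - cst (F r0)) r = u_of_radius q r0 r.
  near=> y; rewrite !fctE /u_of_radius /oint; case: ifPn => [r0y|].
    rewrite split_int//; [exact: ltW|]; apply: lt_trans b1.
    by near: y; exact: lt_nbhsl.
  rewrite -ltNge => yr0; rewrite split_int ?opprB//; last exact: ltW.
  by rewrite ltW//; near: y; exact: lt_nbhsr.
apply: near_eq_is_derive uE _; rewrite -[_^-1]subr0; apply: is_deriveB.
have := is_derive_integral ar rb intf (f_continuous r01).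
by rewrite {2}fE.
Unshelve. all: by end_near. Qed.

Lemma u_of_radius_lt r s : 0 < r -> r < s -> s < pi / 2 ->
  u_of_radius q r0 r < u_of_radius q r0 s.
Proof.
move=> r1 rs s1.
have [||c /andP[rc cs]] := @MVT_for _ (u_of_radius q r0) (fun y => (radius_speed y)^-1) r s rs.
- by move=> y /andP[ry ys]; apply: is_derive_continuous (u_of_radius_derive _); lra.
- by move=> y /andP[ry ys]; apply: u_of_radius_derive; lra.
rewrite -subr_gt0 => ->; rewrite mulr_gt0 ?subr_gt0// invr_gt0 radius_speed_gt0//; lra.
Qed.

Lemma u_of_radius_inj r s : 0 < r < pi / 2 -> 0 < s < pi / 2 ->
  u_of_radius q r0 r = u_of_radius q r0 s -> r = s.
Proof.
move=> /andP[r1 r2] /andP[s1 s2] e; have [rs|sr|//] := ltgtP r s.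
- by have := u_of_radius_lt r1 rs s2; rewrite e ltxx.
- by have := u_of_radius_lt s1 sr r2; rewrite e ltxx.
Qed.

Definition u_range (s : R) : Prop := exists2 r, 0 < r < pi / 2 & u_of_radius q r0 r = s.

Lemma radius_of_uP s : u_range s ->
  0 < radius_of_u q r0 s < pi / 2 /\ u_of_radius q r0 (radius_of_u q r0 s) = s.
Proof.
by move=> [r r1 e]; exact: (@getI _ [set r | 0 < r < pi / 2 /\ u_of_radius q r0 r = s] r).
Qed.

Lemma u_of_radiusK r : 0 < r < pi / 2 -> radius_of_u q r0 (u_of_radius q r0 r) = r.
Proof.
move=> r1; have [|h1 h2] := @radius_of_uP (u_of_radius q r0 r); first by exists r.
exact: u_of_radius_inj h2.
Qed.

Lemma radius_of_u_derive s : u_range s ->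
  is_derive s 1 (radius_of_u q r0) (radius_speed (radius_of_u q r0 s)).
Proof.
move=> [r r1 <-]; rewrite u_of_radiusK// -[radius_speed r]invrK.
have [d d0 Hd] := acute_open r1.
have nr : \forall y \near r, 0 < y < pi / 2.
  exists d => // y; rewrite /ball_ /= distrC; exact: Hd.
apply: is_derive_inverse.
- by apply: filterS nr => y; exact: u_of_radiusK.
- by apply: filterS nr => y y1; exact: is_derive_continuous (u_of_radius_derive y1).
- exact: u_of_radius_derive.
- by rewrite invr_eq0 gt_eqF// radius_speed_gt0.
Qed.

(** Near [s] the map [radius_of_u] is a right inverse of [u_of_radius], and by continuity its values
    stay in the acute interval, so they witness that nearby points are attained. *)
Lemma u_range_open s : u_range s -> exists2 d : R, 0 < d &
  forall t, `|t - s| < d -> u_range t.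
Proof.
move=> Is; have [r1 rs] := radius_of_uP Is; set r := radius_of_u _ _ _ in r1 rs.
have [d d0 Hd] := acute_open r1.
have nr : \forall y \near r, 0 < y < pi / 2.
  exists d => // y; rewrite /ball_ /= distrC; exact: Hd.
have /cvgrPdist_lt/(_ d d0)[e1 /= e10 He1] := is_derive_continuous (radius_of_u_derive Is).
have [] := @near_continuous_can_sym _ (u_of_radius q r0) (radius_of_u q r0) r.
- by apply: filterS nr => y y1; exact: is_derive_continuous (u_of_radius_derive y1).
- by apply: filterS nr => y; exact: u_of_radiusK.
rewrite rs => e2 /= e20 He2; exists (Num.min e1 e2); first by rewrite lt_min e10.
move=> t; rewrite lt_min => /andP[t1 t2].
exists (radius_of_u q r0 t); last by apply: He2; rewrite /ball_ /= distrC.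
by apply: Hd; rewrite distrC; apply: He1; rewrite /ball_ /= distrC.
Qed.

Lemma loc_lip_radius s : u_range s -> loc_lip (radius_of_u q r0) s.
Proof.
move=> Is; have [d d0 Hd] := u_range_open Is.
apply: (loc_lip_derive d0) => [y /Hd|]; first exact: radius_of_u_derive.
have [r1 _] := radius_of_uP Is.
apply: (@continuous_comp _ _ _ (radius_of_u q r0) radius_speed).
  exact: is_derive_continuous (radius_of_u_derive Is).
exact: continuous_radius_speed.
Qed.

End radii.

(** * Derivatives of the edge curvature *)

Section edge_derivatives.
Variables (R : realType) (q : R).
Hypothesis q01 : 0 < q <= 1.
Implicit Types (x y : R).

Let S := sin_outer q.

(** The angles at [Oi] in the triangles through [v1] and [v2], whose legs at [Oi] are the inner and
    the outer radius. *)
Definition angle_in x y : R := atan (S y / (q * cos y * sin x)).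
Definition angle_out x y : R := atan (sin y / (cos y * S x)).

(** The squared sine of the diagonal from [Oi] to [Oj]. *)
Definition hyp_sin2 x y : R := 1 - (q * cos x * cos y) ^+ 2.

(* [radius_speed] times the derivative of [edge_curvature q x y] in [y] *)
Definition edge_coupling x y : R :=
  2 * q ^+ 2 * cos x * cos y * (sin x * sin y + S x * S y) / hyp_sin2 x y.

(* [radius_speed] times the opposite of the derivative in [x], with [cos x ^+ 2]
   and [(q * cos x) ^+ 2] expressed through sines *)
Definition edge_decay x y : R :=
  2 * q * cos x * S x * sin x * (angle_in x y + q * angle_out x y)
  + 2 * q ^+ 2 * cos x * cos y
    * ((1 - sin x ^+ 2) * S x * S y + (1 - S x ^+ 2) * sin x * sin y) / hyp_sin2 x y.

Section acute.
Variables x y : R.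
Hypotheses (x01 : 0 < x < pi / 2) (y01 : 0 < y < pi / 2).

Let q0 : 0 < q. Proof. by case/andP: q01. Qed.
Let sx := sin_gt0_pihalf x01.
Let sy := sin_gt0_pihalf y01.
Let cx := cos_gt0_acute x01.
Let cy := cos_gt0_acute y01.
Let Sx : 0 < S x := sin_outer_gt0 q01 x01.
Let Sy : 0 < S y := sin_outer_gt0 q01 y01.

Let angle_in_denom : S y ^+ 2 + (q * cos y * sin x) ^+ 2 = hyp_sin2 x y.
Proof. by rewrite exprMn /S sin_outer_sqr// sin2cos2 /hyp_sin2; ring. Qed.

Let angle_out_denom : sin y ^+ 2 + (cos y * S x) ^+ 2 = hyp_sin2 x y.
Proof. by rewrite exprMn /S sin_outer_sqr// sin2cos2 /hyp_sin2; ring. Qed.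

Lemma hyp_sin2_gt0 : 0 < hyp_sin2 x y.
Proof. by rewrite -angle_out_denom addr_gt0// exprn_gt0// mulr_gt0. Qed.

Lemma edge_coupling_gt0 : 0 < edge_coupling x y.
Proof. by rewrite divr_gt0 ?hyp_sin2_gt0// !mulr_gt0 ?exprn_gt0// addr_gt0// mulr_gt0. Qed.

(* [sin t * cos t < t] for the two angles of the quadrilateral *)
Lemma edge_coupling_lt_decay : edge_coupling x y < edge_decay x y.
Proof.
have hA := atan_div_gt Sy (mulr_gt0 (mulr_gt0 q0 cy) sx).
have hB := atan_div_gt sy (mulr_gt0 cy Sx).
rewrite angle_in_denom -/(angle_in x y) in hA.
rewrite angle_out_denom -/(angle_out x y) in hB.
rewrite -subr_gt0 (_ : _ - _ = 2 * q * cos x * S x * sin x *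
  ((angle_in x y - S y * (q * cos y * sin x) / hyp_sin2 x y)
   + q * (angle_out x y - sin y * (cos y * S x) / hyp_sin2 x y))).
  by rewrite !mulr_gt0// addr_gt0 ?subr_gt0// mulr_gt0// subr_gt0.
rewrite /edge_decay /edge_coupling; field.
by rewrite gt_eqF// hyp_sin2_gt0.
Qed.

Let E a b := angle_in a b * cos a + angle_out a b * (q * cos a).

Lemma edge_formula_derivel :
  is_derive x 1 (E ^~ y) (- edge_decay x y / radius_speed q x).
Proof.
have hS := sin_outer_derive q01 x01; rewrite -/S in hS.
have hA : is_derive x 1 (angle_in ^~ y) _ :=
  is_derive_atan_div (g := fun a => q * cos y * sin a)
    (lt0r_neq0 (mulr_gt0 (mulr_gt0 q0 cy) sx))
    (is_derive_cst (S y) x (1 : R)) (is_derive_cmul (q * cos y) (is_derive_sin x)).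
have hB : is_derive x 1 (angle_out ^~ y) _ :=
  is_derive_atan_div (g := fun a => cos y * S a)
    (lt0r_neq0 (mulr_gt0 cy Sx))
    (is_derive_cst (sin y) x (1 : R)) (is_derive_cmul (cos y) hS).
have hE := is_deriveD (is_derive_mul hA (is_derive_cos x))
  (is_derive_mul hB (is_derive_cmul q (is_derive_cos x))).
apply: (is_derive_eq hE).
rewrite angle_in_denom angle_out_denom /edge_decay /cst.
(* [edge_decay] is written with sines so that its comparison with [edge_coupling] is a purely
   rational identity; differentiation produces the cosines. *)
have -> : 1 - sin x ^+ 2 = cos x ^+ 2 by rewrite cos2sin2.
have -> : 1 - S x ^+ 2 = (q * cos x) ^+ 2 by rewrite /S sin_outer_sqr//; ring.
rewrite /radius_speed -/S; field.
by rewrite !gt_eqF// hyp_sin2_gt0.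
Qed.

Lemma edge_formula_deriver :
  is_derive y 1 (E x) (edge_coupling x y / radius_speed q y).
Proof.
have hS := sin_outer_derive q01 y01; rewrite -/S in hS.
have hA : is_derive y 1 (angle_in x) _ :=
  is_derive_atan_div (f := S) (g := fun b => q * cos b * sin x)
    (lt0r_neq0 (mulr_gt0 (mulr_gt0 q0 cy) sx)) hS
    (is_derive_mul (is_derive_cmul q (is_derive_cos y)) (is_derive_cst (sin x) y (1 : R))).
have hB : is_derive y 1 (angle_out x) _ :=
  is_derive_atan_div (g := fun b => cos b * S x)
    (lt0r_neq0 (mulr_gt0 cy Sx)) (is_derive_sin y)
    (is_derive_mul (is_derive_cos y) (is_derive_cst (S x) y (1 : R))).
have hE := is_deriveD (is_derive_mul hA (is_derive_cst (cos x) y (1 : R)))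
  (is_derive_mul hB (is_derive_cst (q * cos x) y (1 : R))).
apply: (is_derive_eq hE).
rewrite angle_in_denom angle_out_denom /edge_coupling /cst.
(* The two numerators collapse by cos^2 + sin^2 = 1, for the outer radius here and for the inner one
   in [eB]. *)
have eA : q ^+ 2 * cos y * sin y / S y * (q * cos y * sin x) -
   S y * (q * (- sin y) * sin x + q * cos y * 0) = q * sin x * sin y / S y.
  have e1 : (q * cos y) ^+ 2 = 1 - S y ^+ 2 by rewrite /S sin_outer_sqr//; ring.
  have -> : q * sin x * sin y / S y = q * sin x * sin y * ((q * cos y) ^+ 2 + S y ^+ 2) / S y.
    by rewrite e1 subrK mulr1.
  by field; rewrite gt_eqF.
have eB : cos y * (cos y * S x) - sin y * (- sin y * S x + cos y * 0) = S x.
  have -> : cos y * (cos y * S x) - sin y * (- sin y * S x + cos y * 0)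
    = (cos y ^+ 2 + sin y ^+ 2) * S x by ring.
  by rewrite cos2Dsin2 mul1r.
rewrite eA eB /radius_speed -/S; field.
by rewrite !gt_eqF// hyp_sin2_gt0.
Qed.

End acute.

(** The derivative with respect to the radius is not symmetric; multiplying it by [radius_speed],
    that is, passing to the coordinate u, makes it so. *)
Lemma edge_coupling_sym x y : edge_coupling x y = edge_coupling y x.
Proof.
have e : hyp_sin2 x y = hyp_sin2 y x by rewrite /hyp_sin2; ring.
by rewrite /edge_coupling e; congr (_ / _); ring.
Qed.

Lemma edge_curvature_angles x y : 0 < x < pi / 2 -> 0 < y < pi / 2 ->
  edge_curvature q x y = angle_in x y * cos x + angle_out x y * (q * cos x).
Proof. exact: edge_curvatureE. Qed.

Lemma loc_lip_sin (z : R) : loc_lip (@sin R) z.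
Proof.
apply: (loc_lip_derive ltr01 (fun t _ => is_derive_sin t)).
exact: continuous_cos.
Qed.

Lemma loc_lip_cos (z : R) : loc_lip (@cos R) z.
Proof.
apply: (loc_lip_derive ltr01 (fun t _ => is_derive_cos t)).
by apply: continuousN; exact: continuous_sin.
Qed.

Lemma loc_lip_inv (z : R) : z != 0 -> loc_lip (@GRing.inv R) z.
Proof.
move=> z0; have d (t : R) : `|t - z| < `|z| -> is_derive t 1 (@GRing.inv R) (- t ^- 2).
  move=> tz; have t0 : t != 0 by apply: contraTneq tz => ->; rewrite sub0r normrN ltxx.
  by have := is_derive_inv (f := id) t0 (is_derive_id t (1 : R)); rewrite mulr1.
apply: (loc_lip_derive _ d); first by rewrite normr_gt0.
apply: continuousN; apply: continuousV; first by rewrite expf_neq0.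
exact: exprn_continuous.
Qed.

Lemma loc_lip_atan (z : R) : loc_lip (@atan R) z.
Proof.
apply: (loc_lip_derive ltr01 (fun t _ => is_derive1_atan t)).
apply: continuousV; first by rewrite gt_eqF// ltr_pwDl// sqr_ge0.
by apply: continuousD; [exact: cst_continuous|exact: exprn_continuous].
Qed.

Lemma loc_lip_sin_outer (z : R) : 0 < z < pi / 2 -> loc_lip S z.
Proof.
move=> z1; have [d d0 Hd] := acute_open z1.
apply: (loc_lip_derive d0 (fun t td => sin_outer_derive q01 (Hd t td))).
apply: continuousM.
  apply: continuousM; last exact: continuous_sin.
  by apply: continuousM; [exact: cst_continuous|exact: continuous_cos].
apply: continuousV; first by rewrite gt_eqF// sin_outer_gt0.
exact: is_derive_continuous (sin_outer_derive q01 z1).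
Qed.

Section lipschitz.
Variables (V : normedModType R) (a : V) (f g : V -> R).
Hypotheses (lf : loc_lip f a) (lg : loc_lip g a).
Hypotheses (fa : 0 < f a < pi / 2) (ga : 0 < g a < pi / 2).

Let lsf := loc_lip_comp (loc_lip_sin (f a)) lf.
Let lcf := loc_lip_comp (loc_lip_cos (f a)) lf.
Let lSf := loc_lip_comp (loc_lip_sin_outer fa) lf.
Let lsg := loc_lip_comp (loc_lip_sin (g a)) lg.
Let lcg := loc_lip_comp (loc_lip_cos (g a)) lg.
Let lSg := loc_lip_comp (loc_lip_sin_outer ga) lg.
Let lcst k : loc_lip (fun=> k) a := loc_lip_cst k a.

Let ldiv (F G : V -> R) : loc_lip F a -> loc_lip G a -> G a != 0 ->
  loc_lip (fun u => F u / G u) a.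
Proof. by move=> lF lG G0; apply: loc_lipM => //; exact: loc_lip_comp (loc_lip_inv G0) lG. Qed.

Let lhyp : loc_lip (fun u => hyp_sin2 (f u) (g u)) a.
Proof.
have l := loc_lipM (loc_lipM (lcst q) lcf) lcg.
exact: loc_lipD (lcst 1) (loc_lipN (loc_lipM l l)).
Qed.

Lemma loc_lip_edge_coupling : loc_lip (fun u => edge_coupling (f u) (g u)) a.
Proof.
apply: ldiv lhyp _; last by rewrite gt_eqF// hyp_sin2_gt0.
apply: loc_lipM (loc_lipD (loc_lipM lsf lsg) (loc_lipM lSf lSg)).
by apply: loc_lipM lcg; apply: loc_lipM lcf; exact: lcst.
Qed.

Lemma loc_lip_edge_decay : loc_lip (fun u => edge_decay (f u) (g u)) a.
Proof.
have q0 : 0 < q by case/andP: q01.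
have l1 := lcst 1; have lqc := loc_lipM (lcst q) lcg.
have lA : loc_lip (fun u => angle_in (f u) (g u)) a.
  apply: loc_lip_comp (loc_lip_atan _) _.
  apply: ldiv lSg (loc_lipM lqc lsf) _.
  by rewrite gt_eqF// !mulr_gt0 ?cos_gt0_acute ?sin_gt0_pihalf.
have lB : loc_lip (fun u => angle_out (f u) (g u)) a.
  apply: loc_lip_comp (loc_lip_atan _) _.
  apply: ldiv lsg (loc_lipM lcg lSf) _.
  by rewrite gt_eqF// mulr_gt0 ?cos_gt0_acute// sin_outer_gt0.
apply: loc_lipD.
  apply: loc_lipM (loc_lipD lA (loc_lipM (lcst q) lB)).
  by apply: loc_lipM lsf; apply: loc_lipM lSf; apply: loc_lipM lcf; exact: lcst.
apply: ldiv lhyp _; last by rewrite gt_eqF// hyp_sin2_gt0.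
apply: loc_lipM.
  by apply: loc_lipM lcg; apply: loc_lipM lcf; exact: lcst.
have sq (F : V -> R) : loc_lip F a -> loc_lip (fun u => 1 - F u ^+ 2) a.
  by move=> lF; exact: loc_lipD l1 (loc_lipN (loc_lipM lF lF)).
exact: loc_lipD (loc_lipM (loc_lipM (sq _ lsf) lSf) lSg)
  (loc_lipM (loc_lipM (sq _ lSf) lsf) lsg).
Qed.

End lipschitz.
End edge_derivatives.

(** * Strict differentiability *)

Section strict_differentiability.
Variables (R : realType) (n : nat).
Implicit Types (X L : 'rV[R]_n -> 'rV[R]_n) (a x y z u v : 'rV[R]_n) (B J : 'M[R]_n).

(* The derivative [B] acts on row vectors by right multiplication. *)
Definition strict_derive X a B : Prop := forall e : R, 0 < e -> exists2 d : R, 0 < d &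
  forall u v, `|u - a| < d -> `|v - a| < d ->
    `|X u - X v - (u - v) *m B| <= e * `|u - v|.

Lemma innerE x y : inner x y = (x *m y^T) 0 0.
Proof. by rewrite mxE; apply: eq_bigr => i _; rewrite mxE. Qed.

Lemma innerDl x y z : inner (x + y) z = inner x z + inner y z.
Proof. by rewrite !innerE mulmxDl mxE. Qed.

Lemma inner_mulmx x y B : inner (x *m B) y = inner x (y *m B^T).
Proof. by rewrite !innerE trmx_mul trmxK mulmxA. Qed.

Lemma inner_le_norms x y : inner x y <= n%:R * `|x| * `|y|.
Proof.
have -> : n%:R * `|x| * `|y| = \sum_(i < n) `|x| * `|y|.
  by rewrite sumr_const card_ord -[RHS]mulr_natl mulrA.
apply: ler_sum => i _; apply: le_trans (ler_norm _) _.
by rewrite normrM ler_pM// row_norm_ge.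
Qed.

Lemma row_norm_sqr_le_inner x : `|x| ^+ 2 <= inner x x.
Proof.
rewrite -[leRHS]sqr_sqrtr ?inner_ge0// ler_sqr ?nnegrE ?sqrtr_ge0//.
by apply: row_norm_le_inner; rewrite ?sqrtr_ge0// sqr_sqrtr// inner_ge0.
Qed.

Lemma strict_derive_eq X Y a B (d : R) : 0 < d -> (forall u, `|u - a| < d -> X u = Y u) ->
  strict_derive X a B -> strict_derive Y a B.
Proof.
move=> d0 XY H e /H [d' d'0 Hd']; exists (Num.min d d'); first by rewrite lt_min d0.
by move=> u v; rewrite !lt_min => /andP[ud ud'] /andP[vd vd']; rewrite -!XY//; exact: Hd'.
Qed.

Lemma strict_derive_loc_lip X a B : strict_derive X a B -> loc_lip X a.
Proof.
move=> /(_ 1 ltr01)[d d0 Hd]; exists (1 + n%:R * `|B|), d; split=> // u v ud vd.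
rewrite -[X u - X v](subrK ((u - v) *m B)).
apply: le_trans (ler_normD _ _) _; rewrite mulrDl lerD ?Hd//.
by rewrite mulrAC row_norm_mulmx.
Qed.

Lemma strict_derive_stable X U a B (d c : R) : 0 < d -> 0 < c ->
  (forall u, `|u - a| < d -> U u) -> strict_derive X a B -> X a = 0 ->
  (forall z, inner (z *m B) z <= - c * inner z z) ->
  exists2 V : set 'rV[R]_n, nbhs a V /\ V `<=` U &
    forall u0, V u0 -> solution_exp_converges X U u0 a.
Proof.
move=> d0 c0 dU sX Xa Bneg.
have [K [d1 [K0 d10 HK]]] := strict_derive_loc_lip sX.
(* In sup norms [inner] costs a factor n, so an error of size [e] takes away at most half of the
   negativity [c] of the linear part. *)
pose e := c / (2 * n.+1%:R).
have e0 : 0 < e by rewrite divr_gt0// mulr_gt0.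
have [d2 d20 He] := sX e e0.
(* Halving puts the closed box of radius [r] inside all three open balls. *)
pose r := Num.min d (Num.min d1 d2) / 2.
have [r0 rd rd1 rd2] : [/\ 0 < r, r < d, r < d1 & r < d2].
  have m0 : 0 < Num.min d (Num.min d1 d2) by rewrite !lt_min d0 d10.
  have : r < Num.min d (Num.min d1 d2) by rewrite /r; lra.
  by rewrite !lt_min => /and3P[]; split => //; rewrite /r; lra.
apply: (@dissipative_exp_stable _ _ X U a r (K + 1) (c / 2)) => //.
- by rewrite ltr_wpDl.
- by rewrite divr_gt0.
- by move=> u ur; apply: dU; exact: le_lt_trans rd.
- move=> u v ur vr; apply: le_trans (HK _ _ _ _) _; rewrite ?(le_lt_trans ur)// ?(le_lt_trans vr)//.
  by rewrite ler_wpM2r// lerDl.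
- move=> u v ur vr; set z := u - v.
  have h := He u v (le_lt_trans ur rd2) (le_lt_trans vr rd2); rewrite -/z in h.
  rewrite -[X u - X v](subrK (z *m B)) innerDl.
  have h1 : inner (X u - X v - z *m B) z <= c / 2 * inner z z.
    apply: le_trans (inner_le_norms _ _) _.
    apply: (@le_trans _ _ (n%:R * e * `|z| ^+ 2)).
      have -> : n%:R * e * `|z| ^+ 2 = n%:R * (e * `|z|) * `|z| by ring.
      by rewrite ler_wpM2r// ler_wpM2l.
    apply: (@le_trans _ _ (c / 2 * `|z| ^+ 2)); last first.
      by rewrite ler_wpM2l ?row_norm_sqr_le_inner// divr_ge0// ltW.
    rewrite ler_wpM2r ?sqr_ge0//.
    have -> : n%:R * e = c / 2 * (n%:R / n.+1%:R) by rewrite /e; field.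
    rewrite ler_piMr ?divr_ge0 ?(ltW c0)//.
    by rewrite ler_pdivrMr// mul1r ler_nat.
  have := Bneg z; lra.
Qed.

Lemma strict_derive_dir X a B i j : strict_derive X a B ->
  'D_(delta_mx 0 j) (fun v => X v 0 i) a = B j i.
Proof.
move=> sX; apply: cvg_lim => //; apply/cvgrPdist_le => e e0.
have [d d0 Hd] := sX e e0.
exists d => // h; rewrite /ball_ /= sub0r normrN => hd h0.
pose w : 'rV[R]_n := h *: delta_mx 0 j.
have wn : `|w| <= `|h|.
  rewrite normrZ ler_piMr//; apply/row_norm_leP => // k.
  by rewrite mxE eqxx /=; case: eqP => _; rewrite ?normr1 ?normr0.
have wB : (w *m B) 0 i = h * B j i.
  by rewrite -scalemxAl mxE -rowE mxE.
have := Hd (w + a) a; rewrite addrK subrr normr0 => /(_ (le_lt_trans wn hd) d0) H.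
have {H} := le_trans (row_norm_ge _ i) H; rewrite rowBE rowBE wB => H.
rewrite -[B j i](mulKf h0) /GRing.scale/= -mulrBr normrM normfV distrC.
rewrite ler_pdivrMl ?normr_gt0// (le_trans H)// mulrC ler_wpM2r// ltW//.
Qed.

(** As [L] vanishes at [a], increments of [M] are always multiplied by small values of [L], so a
    Lipschitz bound on [M] replaces its derivative. *)
Lemma strict_derive_product L (M : 'rV[R]_n -> 'M[R]_n) a B :
  strict_derive L a B -> L a = 0 -> loc_lip M a ->
  strict_derive (fun u => - (L u *m M u)) a (- (B *m M a)).
Proof.
move=> sL La lM e e0.
have [K [d1 [K0 d10 HK]]] := strict_derive_loc_lip sL.
have lM0 := loc_lip_near lM.
case: lM => C [d2 [C0 d20 HC]].
(* The three summands come from the remainder of [L], the distance of [M u] from [M a], and the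
   smallness of [L v]; for the last one [e'] also bounds the radius of the neighbourhood. *)
pose e' := e / (n%:R * (`|M a| + K + K * C) + 1).
have N0 : 0 <= `|M a| + K + K * C by rewrite !addr_ge0// mulr_ge0.
have D0 : 0 < n%:R * (`|M a| + K + K * C) + 1 by rewrite ltr_wpDl// mulr_ge0.
have e'0 : 0 < e' by rewrite divr_gt0.
have [d3 d30 HL] := sL e' e'0.
have [d4 d40 HM] := lM0 e' e'0.
exists (Num.min (Num.min d1 d2) (Num.min (Num.min d3 d4) e')).
  by rewrite !lt_min d10 d20 d30 d40.
move=> u v; rewrite !lt_min => /andP[/andP[u1 u2] /andP[/andP[u3 u4] u5]].
move=> /andP[/andP[v1 v2] /andP[/andP[v3 v4] v5]].
have -> : - (L u *m M u) - - (L v *m M v) - (u - v) *m - (B *m M a) =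
  - ((L u - L v - (u - v) *m B) *m M a) - (L u - L v) *m (M u - M a)
  - L v *m (M u - M v).
  rewrite mulmxN mulmxA !mulmxBl !mulmxBr !opprB.
  move: (L u *m M u) (L v *m M v) (L u *m M a) (L v *m M a) (L v *m M u) => p1 p2 p3 p4 p5.
  move: (_ *m M a) (_ *m M a) => p6 p7.
  by apply/rowP => i; rewrite !mxE; ring.
set z := u - v.
have b1 : `|(L u - L v - z *m B) *m M a| <= n%:R * (e' * `|z|) * `|M a|.
  apply: le_trans (row_norm_mulmx _ _) _.
  by rewrite ler_wpM2r// ler_wpM2l// HL.
have b2 : `|(L u - L v) *m (M u - M a)| <= n%:R * (K * `|z|) * e'.
  apply: le_trans (row_norm_mulmx _ _) _.
  by rewrite ler_pM// ?mulr_ge0// ?ler_wpM2l// ?HK// ltW// HM.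
have b3 : `|L v *m (M u - M v)| <= n%:R * (K * e') * (C * `|z|).
  apply: le_trans (row_norm_mulmx _ _) _.
  rewrite ler_pM// ?mulr_ge0// ?HC// ler_wpM2l//.
  rewrite -[L v]subr0 -La; apply: le_trans (HK _ _ _ _) _; rewrite ?subrr ?normr0//.
  by rewrite ler_wpM2l// ltW.
apply: le_trans (ler_normB _ _) _; apply: le_trans (lerD (ler_normB _ _) (lexx _)) _.
rewrite normrN; apply: le_trans (lerD (lerD b1 b2) b3) _.
have -> : n%:R * (e' * `|z|) * `|M a| + n%:R * (K * `|z|) * e' + n%:R * (K * e') * (C * `|z|)
  = e' * (n%:R * (`|M a| + K + K * C)) * `|z| by ring.
rewrite ler_wpM2r//; apply: (@le_trans _ _ (e' * (n%:R * (`|M a| + K + K * C) + 1))).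
  by rewrite ler_wpM2l ?(ltW e'0)// lerDl.
by rewrite /e' divfK// gt_eqF.
Qed.

(* For symmetric [J], [|z J + c z|^2 >= 0] turns the bound on [J] into one on
   [- J^2]. *)
Lemma symmetric_sqr_negative J (c : R) : 0 < c -> J^T = J ->
  (forall z, inner (z *m J) z <= - c * inner z z) ->
  forall z, inner (z *m - (J *m J)) z <= - c ^+ 2 * inner z z.
Proof.
move=> c0 Jsym Jneg z.
have -> : inner (z *m - (J *m J)) z = - inner (z *m J) (z *m J).
  by rewrite mulmxN mulmxA -scaleN1r innerZl mulN1r (inner_mulmx (z *m J) z) Jsym.
have := inner_ge0 (z *m J + c *: z).
have -> : inner (z *m J + c *: z) (z *m J + c *: z) =
    inner (z *m J) (z *m J) + 2 * c * inner (z *m J) z + c ^+ 2 * inner z z.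
  rewrite /inner !mulr_sumr -!big_split /=; apply: eq_bigr => i _.
  have -> : (z *m J + c *: z) 0 i = (z *m J) 0 i + c * z 0 i.
    by rewrite mxE [X in _ + X]mxE.
  by ring.
have := Jneg z; nra.
Qed.

(** Over a unit time interval the mean value theorem equates a coordinate of [X] at an intermediate
    point with an increment of [p]. Late in time the increment is small and that point is close to
    [a]. *)
Lemma convergent_solution_zero X U (p : R -> 'rV[R]_n) a :
  is_solution X U +oo%E p -> p t @[t --> +oo] --> a -> loc_lip X a -> X a = 0.
Proof.
move=> sp pa lX; apply/eqP; rewrite -normr_le0; apply/ler_addgt0Pr => e e0.
rewrite add0r; apply/row_norm_leP => [|i]; first exact: ltW.
have e3 : 0 < e / 3 by rewrite divr_gt0.
have [d d0 Hd] := loc_lip_near lX e3.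
have m0 : 0 < Num.min d (e / 3) by rewrite lt_min d0.
move/cvgrPdist_lt/(_ _ m0): pa => [M [_ HM]].
pose t := Num.max M 0 + 1.
have tM s : t <= s -> M < s.
  by apply: lt_le_trans; rewrite /t; case: (leP M 0) => ?; lra.
have t0 : 0 < t by rewrite /t; case: (leP M 0) => ?; lra.
have near_a s : t <= s -> `|p s - a| < d /\ `|p s - a| < e / 3.
  by move=> /tM/HM; rewrite distrC lt_min => /andP.
have tt1 : t <= t + 1 by rewrite lerDl.
have cp (s : R) : t <= s <= t + 1 -> {for s, continuous (fun s : R => p `|s| 0 i)}.
  case/andP => ts _; have s0 : 0 <= s by lra.
  exact: (solution_continuous sp s0 (ltry _)).
have dp (s : R) : t < s < t + 1 ->
    is_derive s 1 (fun s : R => p `|s| 0 i) (X (p s) 0 i).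
  case/andP => ts _; have s0 : 0 < s by lra.
  exact: (solution_derive i sp s0 (ltry _)).
have [c /andP[tc _]] := MVT_segment_for tt1 cp dp.
have t1 : 0 < t + 1 by lra.
rewrite (gtr0_norm t1) (gtr0_norm t0) (_ : t + 1 - t = 1) ?mulr1; last (by ring); move=> ec.
have h1 : `|X (p c) 0 i - X a 0 i| < e / 3.
  by rewrite -rowBE (le_lt_trans (row_norm_ge _ _))// Hd//; have [] := near_a c tc.
have h2 : `|p (t + 1) 0 i - a 0 i| < e / 3.
  by rewrite -rowBE (le_lt_trans (row_norm_ge _ _))//; have [] := near_a _ tt1.
have h3 : `|p t 0 i - a 0 i| < e / 3.
  by rewrite -rowBE (le_lt_trans (row_norm_ge _ _))//; have [] := near_a _ (lexx t).
move: h1 h2 h3; rewrite !ltr_norml ler_norml; lra.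
Qed.

End strict_differentiability.

Section matrix_valued.
Variables (R : realType) (V : normedModType R).

Lemma loc_lip_entry m n (F : V -> 'M[R]_(m, n)) a i j :
  loc_lip F a -> loc_lip (fun u => F u i j) a.
Proof.
move=> [K [d [K0 d0 H]]]; exists K, d; split=> // u v ud vd.
by have := le_trans (mx_norm_ge _ i j) (H u v ud vd); rewrite !mxE.
Qed.

Lemma loc_lip_mx m n (F : V -> 'M[R]_(m, n)) a :
  (forall i j, loc_lip (fun u => F u i j) a) -> loc_lip F a.
Proof.
move=> H.
have /choice[K /choice[d Hd]] (ij : 'I_m * 'I_n) : exists K d : R, [/\ 0 <= K, 0 < d &
    forall u v, `|u - a| < d -> `|v - a| < d ->
      `|F u ij.1 ij.2 - F v ij.1 ij.2| <= K * `|u - v|] by exact: H.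
have K0 ij : 0 <= K ij by case: (Hd ij).
exists (\sum_ij K ij), (\big[Num.min/1]_ij d ij); split.
- exact: sumr_ge0.
- by elim/big_ind: _ => // [x y x0 y0|ij _]; [rewrite lt_min x0|case: (Hd ij)].
- move=> u v ud vd; apply/mx_norm_leP => [|i j].
    by rewrite mulr_ge0// sumr_ge0.
  have [_ _ /(_ u v)] := Hd (i, j); rewrite !mxE => /(_ _ _)/le_trans; apply.
  + exact: lt_le_trans ud (bigmin_le_cond _ _ _).
  + exact: lt_le_trans vd (bigmin_le_cond _ _ _).
  + by rewrite ler_wpM2r// (bigD1 (i, j))//= lerDl sumr_ge0.
Qed.

Lemma loc_lip_mulmx m n k (F : V -> 'M[R]_(m, n)) (G : V -> 'M[R]_(n, k)) a :
  loc_lip F a -> loc_lip G a -> loc_lip (fun u => F u *m G u) a.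
Proof.
move=> lF lG; apply: loc_lip_mx => i j.
rewrite (_ : (fun _ => _) = fun u => \sum_l F u i l * G u l j); last first.
  by apply/funext => u; rewrite mxE.
by apply: loc_lip_sum => l; apply: loc_lipM; exact: loc_lip_entry.
Qed.

End matrix_valued.

Section two_variables.
Variable R : realType.

Lemma ball_MVT (f f' : R -> R) (x d a b : R) :
  (forall y, `|y - x| < d -> is_derive y 1 f (f' y)) ->
  `|a - x| < d -> `|b - x| < d ->
  exists2 c, `|c - x| < d & f b - f a = f' c * (b - a).
Proof.
move=> df; wlog ab : a b / a <= b => [H ax bx|].
  have [ab|/ltW ba] := leP a b; first exact: H.
  have [c cx e] := H b a ba bx ax; exists c => //.
  by rewrite -opprB e -mulrN opprB.
rewrite !ltr_norml => /andP[a1 a2] /andP[b1 b2].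
have itv y : a <= y <= b -> `|y - x| < d by rewrite ltr_norml; lra.
have cf y : a <= y <= b -> {for y, continuous f}.
  by move=> /itv/df; exact: is_derive_continuous.
have df' y : a < y < b -> is_derive y 1 f (f' y) by move=> h; apply/df/itv; lra.
by have [c /itv] := MVT_segment_for ab cf df'; exists c.
Qed.

(** The increment is split at (s', t), so that each leg changes one variable and falls under the
    mean value theorem; continuity of the partial derivatives at the centre bounds the error. *)
Lemma strict_derive2 (G G1 G2 : R -> R -> R) (s0 t0 d : R) : 0 < d ->
  (forall s t, `|s - s0| < d -> `|t - t0| < d -> is_derive s 1 (G ^~ t) (G1 s t)) ->
  (forall s t, `|s - s0| < d -> `|t - t0| < d -> is_derive t 1 (G s) (G2 s t)) ->
  loc_lip (fun p : R * R => G1 p.1 p.2) (s0, t0) ->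
  loc_lip (fun p : R * R => G2 p.1 p.2) (s0, t0) ->
  forall e : R, 0 < e -> exists2 d' : R, 0 < d' & forall s t s' t',
    `|s - s0| < d' -> `|t - t0| < d' -> `|s' - s0| < d' -> `|t' - t0| < d' ->
    `|G s t - G s' t' - (G1 s0 t0 * (s - s') + G2 s0 t0 * (t - t'))|
      <= e * (`|s - s'| + `|t - t'|).
Proof.
move=> d0 dG1 dG2 /loc_lip_near l1 /loc_lip_near l2 e e0.
have [d1 d10 H1] := l1 e e0; have [d2 d20 H2] := l2 e e0.
pose r := Num.min d (Num.min d1 d2); exists r; first by rewrite !lt_min d0 d10.
have rd z : z < r -> z < d by rewrite lt_min => /andP[].
have rd1 z : z < r -> z < d1 by rewrite !lt_min => /and3P[].
have rd2 z : z < r -> z < d2 by rewrite !lt_min => /and3P[].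
have pairE x y : `|(x, y) - (s0, t0)| = Num.max `|x - s0| `|y - t0| by [].
move=> s t s' t' sr tr s'r t'r.
have [c cr e1] := ball_MVT (fun y yr => dG1 y t (rd _ yr) (rd _ tr)) s'r sr.
have [b br e2] := ball_MVT (fun y yr => dG2 s' y (rd _ s'r) (rd _ yr)) t'r tr.
have h1 : `|G1 c t - G1 s0 t0| <= e.
  by apply/ltW/(H1 (c, t)); rewrite pairE gt_max !rd1.
have h2 : `|G2 s' b - G2 s0 t0| <= e.
  by apply/ltW/(H2 (s', b)); rewrite pairE gt_max !rd2.
have -> : G s t - G s' t' - (G1 s0 t0 * (s - s') + G2 s0 t0 * (t - t')) =
    (G1 c t - G1 s0 t0) * (s - s') + (G2 s' b - G2 s0 t0) * (t - t').
  have -> : G s t - G s' t' = (G s t - G s' t) + (G s' t - G s' t') by ring.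
  by rewrite e1 e2; ring.
apply: le_trans (ler_normD _ _) _; rewrite [leRHS]mulrDr !normrM.
by rewrite lerD// ler_wpM2r.
Qed.

End two_variables.

(** * Jacobian of the total curvature *)

Section network.
Variables (R : realType) (T : finType) (n : nat) (F : T -> 'I_n) (o : T -> T).
Variables (g P Q : R -> R -> R) (I : R -> Prop).
Hypothesis oK : involutive o.
Hypothesis F_surj : forall i, exists x, F x = i.
Hypothesis I_open : forall s, I s -> exists2 d : R, 0 < d &
  forall t, `|t - s| < d -> I t.
Hypothesis dgl : forall s t, I s -> I t -> is_derive s 1 (g ^~ t) (- P s t).
Hypothesis dgr : forall s t, I s -> I t -> is_derive t 1 (g s) (Q s t).
Hypothesis lP : forall s t, I s -> I t -> loc_lip (fun p : R * R => P p.1 p.2) (s, t).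
Hypothesis lQ : forall s t, I s -> I t -> loc_lip (fun p : R * R => Q p.1 p.2) (s, t).
Hypothesis Q_sym : forall s t, Q s t = Q t s.
Hypothesis Q_ge0 : forall s t, I s -> I t -> 0 <= Q s t.
Hypothesis Q_lt_P : forall s t, I s -> I t -> Q s t < P s t.
Implicit Types (u v z : 'rV[R]_n) (x : T) (i j : 'I_n).

(** The total curvature stripped of its geometry: [T] stands for the flags, [F] for their face, [o]
    for crossing the edge and [g] for the edge curvature in the coordinates u. Trigonometry enters
    only through the hypotheses on [P] and [Q]. *)
Definition network_sum u : 'rV[R]_n :=
  \row_i (2^-1 * \sum_(x | F x == i) g (u 0 (F x)) (u 0 (F (o x)))).

Let Pu u x := P (u 0 (F x)) (u 0 (F (o x))).
Let Qu u x := Q (u 0 (F x)) (u 0 (F (o x))).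

Definition network_jacobian u : 'M[R]_n := \matrix_(i, j)
  (2^-1 * \sum_(x | F x == i)
     (Qu u x * (F (o x) == j)%:R - Pu u x * (F x == j)%:R)).

Let Qu_o u x : Qu u (o x) = Qu u x.
Proof. by rewrite /Qu oK Q_sym. Qed.

(** Reindexing the coupling sum by [o] exchanges the two faces and preserves [Q]; the decay terms
    are diagonal. *)
Lemma network_jacobian_sym u : (network_jacobian u)^T = network_jacobian u.
Proof.
have E i j : network_jacobian u i j =
    2^-1 * (\sum_x Qu u x * ((F x == i)%:R * (F (o x) == j)%:R)
            - \sum_x Pu u x * ((F x == i)%:R * (F x == j)%:R)).
  rewrite mxE; congr (_ * _); rewrite big_mkcond -sumrB; apply: eq_bigr => x _.
  by case: (F x == i); rewrite /= ?mul1r ?mul0r ?mulr0 ?subrr.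
apply/matrixP => i j; rewrite mxE !E; congr (_ * (_ - _)); last first.
  by apply: eq_bigr => x _; congr (_ * _); rewrite mulrC.
rewrite (reindex_inj (inv_inj oK)); apply: eq_bigr => x _.
by rewrite Qu_o oK [X in _ * X]mulrC.
Qed.

Lemma mul_network_jacobian u z i : (z *m network_jacobian u) 0 i =
  2^-1 * \sum_(x | F x == i) (Qu u x * z 0 (F (o x)) - Pu u x * z 0 (F x)).
Proof.
have pick k : \sum_j z 0 j * (k == j)%:R = z 0 k.
  rewrite (bigD1 k)//= eqxx mulr1 big1 ?addr0// => j jk.
  by rewrite eq_sym (negbTE jk) mulr0.
rewrite -{1}network_jacobian_sym mxE.
under eq_bigr do rewrite !mxE mulrCA mulr_sumr.
rewrite -mulr_sumr exchange_big /=; congr (_ * _); apply: eq_bigr => x _.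
rewrite -(pick (F (o x))) -(pick (F x)) !mulr_sumr -sumrB.
by apply: eq_bigr => j _; ring.
Qed.

Lemma network_domain_open u : (forall i, I (u 0 i)) -> exists2 d : R, 0 < d &
  forall v, `|v - u| < d -> forall i, I (v 0 i).
Proof.
move=> Iu.
have /choice[d Hd] i : exists d : R, 0 < d /\ forall t, `|t - u 0 i| < d -> I t.
  by have [d d0 Hd] := I_open (Iu i); exists d.
exists (\big[Num.min/1]_i d i).
  by elim/big_ind: _ => // [a b a0 b0|i _]; [rewrite lt_min a0|case: (Hd i)].
move=> v vu i; have [_] := Hd i; apply; rewrite -rowBE.
apply: le_lt_trans (row_norm_ge _ i) _; apply: lt_le_trans vu _.
exact: bigmin_le_cond.
Qed.

Let loc_lip_edge (G : R -> R -> R) u x : (forall i, I (u 0 i)) ->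
  (forall s t, I s -> I t -> loc_lip (fun p : R * R => G p.1 p.2) (s, t)) ->
  loc_lip (fun v => G (v 0 (F x)) (v 0 (F (o x)))) u.
Proof.
move=> Iu lG; pose f v : R * R := (v 0 (F x), v 0 (F (o x))).
apply: (loc_lip_comp (f := fun p : R * R => G p.1 p.2) (F := f)).
  exact: lG.
exists 1, 1; split => // a b _ _; rewrite mul1r.
have -> : `|f a - f b| =
  Num.max `|a 0 (F x) - b 0 (F x)| `|a 0 (F (o x)) - b 0 (F (o x))| by [].
by rewrite ge_max -!rowBE !row_norm_ge.
Qed.

Lemma loc_lip_network_jacobian u : (forall i, I (u 0 i)) ->
  loc_lip network_jacobian u.
Proof.
move=> Iu; apply: loc_lip_mx => i j.
rewrite (_ : (fun _ => _) = fun v => 2^-1 * \sum_(x | F x == i)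
    (Qu v x * (F (o x) == j)%:R + - (Pu v x * (F x == j)%:R))); last first.
  by apply/funext => v; rewrite mxE.
apply: loc_lipM; first exact: loc_lip_cst.
apply: loc_lip_sum => x; apply: loc_lipD; last apply: loc_lipN.
  by apply: loc_lipM; [exact: loc_lip_edge|exact: loc_lip_cst].
by apply: loc_lipM; [exact: loc_lip_edge|exact: loc_lip_cst].
Qed.

Lemma network_strict_derive u : (forall i, I (u 0 i)) ->
  strict_derive network_sum u (network_jacobian u).
Proof.
move=> Iu e e0.
(* At most #|T| flags contribute, each with error [e'] times twice the norm; the 2 cancels the
   factor 1/2 of [network_sum]. *)
pose e' := e / (#|T|%:R + 1).
have N0 : 0 < (#|T|%:R + 1 : R) by rewrite ltr_wpDl.
have e'0 : 0 < e' by rewrite divr_gt0.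
have /choice[d Hd] x : exists d : R, 0 < d /\ forall s t s' t',
    `|s - u 0 (F x)| < d -> `|t - u 0 (F (o x))| < d ->
    `|s' - u 0 (F x)| < d -> `|t' - u 0 (F (o x))| < d ->
    `|g s t - g s' t' - (- Pu u x * (s - s') + Qu u x * (t - t'))|
      <= e' * (`|s - s'| + `|t - t'|).
  have [d1 d10 Hd1] := I_open (Iu (F x)); have [d2 d20 Hd2] := I_open (Iu (F (o x))).
  pose d := Num.min d1 d2.
  have d0 : 0 < d by rewrite lt_min d10.
  have Is s : `|s - u 0 (F x)| < d -> I s by rewrite lt_min => /andP[/Hd1].
  have It t : `|t - u 0 (F (o x))| < d -> I t by rewrite lt_min => /andP[_ /Hd2].
  have lNP : loc_lip (fun p : R * R => - P p.1 p.2) (u 0 (F x), u 0 (F (o x))).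
    exact/loc_lipN/lP.
  have [d' d'0 H] := strict_derive2 (G1 := fun s t => - P s t) d0
    (fun s t sd td => dgl (Is _ sd) (It _ td))
    (fun s t sd td => dgr (Is _ sd) (It _ td)) lNP (lQ (Iu _) (Iu _)) e'0.
  by exists d'; split => // s t s' t'; exact: H.
exists (\big[Num.min/1]_x d x).
  by elim/big_ind: _ => // [a b a0 b0|x _]; [rewrite lt_min a0|case: (Hd x)].
move=> v w vd wd; apply/row_norm_leP => [|i]; first by rewrite mulr_ge0// ltW.
set z := v - w.
have near_u k x (y : 'rV[R]_n) : `|y - u| < \big[Num.min/1]_x d x -> `|y 0 k - u 0 k| < d x.
  move=> yd; rewrite -rowBE; apply: le_lt_trans (row_norm_ge _ _) _.
  by apply: lt_le_trans yd _; exact: bigmin_le_cond.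
rewrite rowBE rowBE mul_network_jacobian !mxE -!mulrBr -!sumrB normrM.
rewrite ger0_norm ?invr_ge0//.
apply: (@le_trans _ _ (2^-1 * \sum_(x : T) e' * (2 * `|z|))).
  rewrite ler_wpM2l ?invr_ge0//; apply: le_trans (ler_norm_sum _ _ _) _.
  rewrite big_mkcond /=; apply: ler_sum => x _; case: ifP => _; last first.
    by rewrite mulr_ge0 ?(ltW e'0)// mulr_ge0.
  have [_ H] := Hd x.
  have -> : Qu u x * z 0 (F (o x)) - Pu u x * z 0 (F x) =
    - Pu u x * (v 0 (F x) - w 0 (F x)) + Qu u x * (v 0 (F (o x)) - w 0 (F (o x))).
    by rewrite /z !rowBE; ring.
  apply: le_trans (H _ _ _ _ _ _ _ _) _; rewrite ?near_u//.
  rewrite ler_wpM2l ?(ltW e'0)// mulr_natl mulr2n.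
  by rewrite lerD// -rowBE row_norm_ge.
rewrite sumr_const -[X in 2^-1 * X]mulr_natl.
have -> : 2^-1 * (#|T|%:R * (e' * (2 * `|z|))) = #|T|%:R * e' * `|z| by field.
rewrite ler_wpM2r//; apply: (@le_trans _ _ ((#|T|%:R + 1) * e')).
  by rewrite ler_wpM2r ?(ltW e'0)// lerDl.
by rewrite mulrC divfK// gt_eqF.
Qed.

(** By 2 a b <= a^2 + b^2 and reindexing by [o], the quadratic form is at most minus half the sum
    over flags of (P - Q) times the squared coordinate of their face. Each coordinate is counted at
    least once because every face owns a flag. *)
Lemma network_jacobian_negative u : (forall i, I (u 0 i)) ->
  exists2 c : R, 0 < c & forall z,
    inner (z *m network_jacobian u) z <= - c * inner z z.
Proof.
move=> Iu; pose c := \big[Num.min/1]_x (Pu u x - Qu u x).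
have c0 : 0 < c.
  rewrite /c; elim/big_ind: _ => // [a b a0 b0|x _]; first by rewrite lt_min a0.
  by rewrite subr_gt0 Q_lt_P.
have cx x : c <= Pu u x - Qu u x by exact: bigmin_le_cond.
have group (h : T -> R) : \sum_i \sum_(x | F x == i) h x = \sum_x h x.
  by rewrite (partition_big F xpredT).
exists (2^-1 * c); first by rewrite mulr_gt0.
move=> z.
have -> : inner (z *m network_jacobian u) z =
    2^-1 * \sum_x (Qu u x * z 0 (F (o x)) - Pu u x * z 0 (F x)) * z 0 (F x).
  rewrite -group mulr_sumr; apply: eq_bigr => i _.
  rewrite mul_network_jacobian -mulrA mulr_suml; congr (_ * _).
  by apply: eq_bigr => x /eqP->.
rewrite mulNr -mulrA -mulrN ler_pM2l ?invr_gt0//.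
have sumQ : \sum_x Qu u x * z 0 (F (o x)) ^+ 2 = \sum_x Qu u x * z 0 (F x) ^+ 2.
  rewrite (reindex_inj (inv_inj oK)); apply: eq_bigr => x _.
  by rewrite Qu_o oK.
have bound : \sum_x (Qu u x * z 0 (F (o x)) - Pu u x * z 0 (F x)) * z 0 (F x) <=
    - \sum_x (Pu u x - Qu u x) * z 0 (F x) ^+ 2.
  have -> : - \sum_x (Pu u x - Qu u x) * z 0 (F x) ^+ 2 =
    \sum_x (2^-1 * (Qu u x * z 0 (F (o x)) ^+ 2 + Qu u x * z 0 (F x) ^+ 2)
           - Pu u x * z 0 (F x) ^+ 2).
    rewrite sumrB -mulr_sumr big_split /= sumQ -!big_split /= -sumrN.
    rewrite mulr_sumr -sumrB; apply: eq_bigr => x _; lra.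
  apply: ler_sum => x _; rewrite -subr_ge0.
  have -> : 2^-1 * (Qu u x * z 0 (F (o x)) ^+ 2 + Qu u x * z 0 (F x) ^+ 2)
      - Pu u x * z 0 (F x) ^+ 2
      - (Qu u x * z 0 (F (o x)) - Pu u x * z 0 (F x)) * z 0 (F x)
     = 2^-1 * (Qu u x * (z 0 (F (o x)) - z 0 (F x)) ^+ 2) by field.
  by rewrite mulr_ge0 ?invr_ge0// mulr_ge0 ?sqr_ge0// Q_ge0.
apply: le_trans bound _; rewrite lerN2.
apply: (@le_trans _ _ (\sum_x c * z 0 (F x) ^+ 2)); last first.
  by apply: ler_sum => x _; rewrite ler_wpM2r ?sqr_ge0.
rewrite -mulr_sumr ler_wpM2l ?(ltW c0)// -group; apply: ler_sum => i _.
have [x Fx] := F_surj i.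
rewrite (bigD1 x) ?Fx//= -expr2 lerDl.
by apply: sumr_ge0 => y _; rewrite sqr_ge0.
Qed.

End network.

(** * The combinatorial Ricci and Calabi flows *)

Section flows.
Variables (R : realType) (S : cell_decomposition) (q r0 : R).
Hypothesis q01 : 0 < q <= 1.
Hypothesis r0_acute : 0 < r0 < pi / 2.
Notation n := (nfaces S).
Implicit Types (u v : 'rV[R]_n) (s t : R).

Let rho := radius_of_u q r0.
Let I := u_range q r0.
Let g s t := edge_curvature q (rho s) (rho t).
Let P s t := edge_decay q (rho s) (rho t).
Let Q s t := edge_coupling q (rho s) (rho t).

Let rho_acute s : I s -> 0 < rho s < pi / 2.
Proof. by move=> /(radius_of_uP)[]. Qed.

Let near_I s : I s -> \forall t \near s, I t.
Proof.
move=> /(u_range_open q01 r0_acute)[d d0 Hd]; exists d => // t.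
by rewrite /ball_ /= distrC; exact: Hd.
Qed.

Lemma edge_curvature_derivel s t : I s -> I t -> is_derive s 1 (g ^~ t) (- P s t).
Proof.
move=> Is It; have w0 := radius_speed_gt0 q01 (rho_acute Is).
have h := is_derive1_comp (edge_formula_derivel q01 (rho_acute Is) (rho_acute It))
  (radius_of_u_derive q01 r0_acute Is).
rewrite divfK ?gt_eqF// in h; apply: near_eq_is_derive h.
apply: filterS (near_I Is) => s' Is' /=.
by rewrite /g edge_curvature_angles ?rho_acute.
Qed.

Lemma edge_curvature_deriver s t : I s -> I t -> is_derive t 1 (g s) (Q s t).
Proof.
move=> Is It; have w0 := radius_speed_gt0 q01 (rho_acute It).
have h := is_derive1_comp (edge_formula_deriver q01 (rho_acute Is) (rho_acute It))
  (radius_of_u_derive q01 r0_acute It).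
rewrite divfK ?gt_eqF// in h; apply: near_eq_is_derive h.
apply: filterS (near_I It) => t' It' /=.
by rewrite /g edge_curvature_angles ?rho_acute.
Qed.

Let lip_fst s t : I s -> loc_lip (fun p : R * R => rho p.1) (s, t).
Proof.
move=> Is; apply: loc_lip_comp (loc_lip_radius q01 r0_acute Is) _.
exists 1, 1; split => // x y _ _; rewrite mul1r.
have -> : `|x - y| = Num.max `|x.1 - y.1| `|x.2 - y.2| by [].
by rewrite le_max lexx.
Qed.

Let lip_snd s t : I t -> loc_lip (fun p : R * R => rho p.2) (s, t).
Proof.
move=> It; apply: loc_lip_comp (loc_lip_radius q01 r0_acute It) _.
exists 1, 1; split => // x y _ _; rewrite mul1r.
have -> : `|x - y| = Num.max `|x.1 - y.1| `|x.2 - y.2| by [].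
by rewrite le_max lexx orbT.
Qed.

Let lP s t : I s -> I t -> loc_lip (fun p : R * R => P p.1 p.2) (s, t).
Proof.
move=> Is It; apply: (loc_lip_edge_decay q01 (lip_fst t Is) (lip_snd s It)).
  exact: rho_acute.
exact: rho_acute.
Qed.

Let lQ s t : I s -> I t -> loc_lip (fun p : R * R => Q p.1 p.2) (s, t).
Proof.
move=> Is It; apply: (loc_lip_edge_coupling q01 (lip_fst t Is) (lip_snd s It)).
  exact: rho_acute.
exact: rho_acute.
Qed.

Let F := @face S.
Let o := @a2 S.

Lemma face_surj (i : 'I_n) : exists x, F x = i.
Proof.
have /imsetP[x _ e] : enum_val i \in faces S by exact: enum_valP.
by exists x; apply: enum_val_inj; rewrite enum_rankK_in ?face_of_in.
Qed.

Lemma admissibleP u : admissible q r0 u <-> forall i, I (u 0 i).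
Proof.
split=> [[r Hr] i|H]; first by have [r1 ->] := Hr i; exists (r i).
exists (fun i => rho (u 0 i)) => i; have [r1 e] := radius_of_uP (H i).
by rewrite /rho e.
Qed.

Lemma LmapE u : Lmap q r0 u = network_sum F o g u.
Proof.
apply/rowP => i; rewrite !mxE; congr (_ * _).
by apply: eq_bigr => x /eqP <-.
Qed.

Let J := network_jacobian F o P Q.

Let oK : involutive o. Proof. exact: a2K. Qed.

Lemma Lmap_strict_derive u : (forall i, I (u 0 i)) -> strict_derive (Lmap q r0) u (J u).
Proof.
move=> Iu; rewrite (_ : Lmap q r0 = network_sum F o g); last exact/funext/LmapE.
apply: network_strict_derive Iu => //.
- exact: u_range_open.
- exact: edge_curvature_derivel.
- exact: edge_curvature_deriver.
- by move=> s t; exact: edge_coupling_sym.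
Qed.

Let J_sym u : (J u)^T = J u.
Proof. by apply: network_jacobian_sym => // s t; exact: edge_coupling_sym. Qed.

(** A derivative acting on row vectors is the transpose of the matrix of partial derivatives;
    symmetry of [J] removes the difference. *)
Lemma DeltaE u : (forall i, I (u 0 i)) -> Delta q r0 u = J u.
Proof.
move=> Iu; apply/matrixP => i j; rewrite mxE.
by rewrite (strict_derive_dir i j (Lmap_strict_derive Iu)) -[in RHS]J_sym [RHS]mxE.
Qed.

Let J_neg u : (forall i, I (u 0 i)) -> exists2 c : R, 0 < c & forall z,
  inner (z *m J u) z <= - c * inner z z.
Proof.
apply: network_jacobian_negative => //; first exact: face_surj.
- by move=> s t; exact: edge_coupling_sym.
- by move=> s t Is It; rewrite ltW// edge_coupling_gt0// rho_acute.
- by move=> s t Is It; rewrite edge_coupling_lt_decay// rho_acute.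
Qed.

Let loc_lip_J u : (forall i, I (u 0 i)) -> loc_lip J u.
Proof. move=> Iu; exact: (@loc_lip_network_jacobian _ _ _ _ _ _ _ I). Qed.

Let near_domain u : (forall i, I (u 0 i)) -> exists2 d : R, 0 < d &
  forall v, `|v - u| < d -> forall i, I (v 0 i).
Proof. by apply: network_domain_open => s; exact: u_range_open. Qed.

Variable Lhat : 'rV[R]_n.

Lemma calabi_fieldE u : (forall i, I (u 0 i)) ->
  calabi_field q r0 Lhat u = - (ricci_field q r0 Lhat u *m J u).
Proof.
move=> Iu; apply/rowP => i; rewrite -{1}J_sym mxE [RHS]mxE; congr (- _).
rewrite [RHS]mxE; apply: eq_bigr => j _.
by rewrite DeltaE// [(J u)^T _ _]mxE mulrC.
Qed.

Lemma ricci_strict_derive u : (forall i, I (u 0 i)) ->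
  strict_derive (ricci_field q r0 Lhat) u (J u).
Proof.
move=> /Lmap_strict_derive H e /H[d d0 Hd]; exists d => // v w vd wd.
rewrite (_ : ricci_field q r0 Lhat v - ricci_field q r0 Lhat w
  = Lmap q r0 v - Lmap q r0 w); first exact: Hd.
by apply/rowP => i; rewrite !rowBE; ring.
Qed.

Lemma loc_lip_calabi u : (forall i, I (u 0 i)) -> loc_lip (calabi_field q r0 Lhat) u.
Proof.
move=> Iu; have [d d0 Hd] := near_domain Iu.
apply: (loc_lip_eq (F := fun v => - (ricci_field q r0 Lhat v *m J v)) d0).
  by move=> v /Hd Iv; rewrite calabi_fieldE.
apply: loc_lip_mx => i j.
rewrite (_ : (fun _ => _) = fun v => - (ricci_field q r0 Lhat v *m J v) i j); last first.
  by apply/funext => v; rewrite mxE.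
apply/loc_lipN/loc_lip_entry/loc_lip_mulmx; last exact: loc_lip_J.
exact/strict_derive_loc_lip/ricci_strict_derive.
Qed.

Lemma flow_limit (p : R -> 'rV[R]_n) u :
  is_solution (ricci_field q r0 Lhat) (admissible q r0) +oo%E p
  \/ is_solution (calabi_field q r0 Lhat) (admissible q r0) +oo%E p ->
  admissible q r0 u -> p t @[t --> +oo] --> u -> Lmap q r0 u = Lhat.
Proof.
move=> sp /admissibleP Iu pu; suff /eqP : ricci_field q r0 Lhat u = 0.
  by rewrite subr_eq0 => /eqP.
case: sp => sp.
  apply: convergent_solution_zero sp pu _.
  exact/strict_derive_loc_lip/ricci_strict_derive.
(* A zero of the Calabi field only gives (L - Lhat) J = 0; definiteness of [J] then forces L =
   Lhat. *)
have := convergent_solution_zero sp pu (loc_lip_calabi Iu).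
rewrite calabi_fieldE// => /eqP; rewrite oppr_eq0 => /eqP z0.
have [c c0 Hc] := J_neg Iu; have := Hc (ricci_field q r0 Lhat u).
rewrite z0 => H; apply: inner_eq0; move: H.
rewrite (_ : inner 0 _ = 0); last by rewrite /inner big1// => i _; rewrite mxE mul0r.
by rewrite mulNr oppr_ge0 pmulr_rle0.
Qed.

Lemma flow_stable u : admissible q r0 u -> Lmap q r0 u = Lhat ->
  exists2 V : set 'rV[R]_n, nbhs u V /\ V `<=` admissible q r0 &
    forall u0, V u0 ->
      solution_exp_converges (ricci_field q r0 Lhat) (admissible q r0) u0 u
      /\ solution_exp_converges (calabi_field q r0 Lhat) (admissible q r0) u0 u.
Proof.
move=> /admissibleP Iu Lu; have [d d0 Hd] := near_domain Iu.
have [c c0 Hc] := J_neg Iu.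
have dU v : `|v - u| < d -> admissible q r0 v by move=> /Hd/admissibleP.
have R0 : ricci_field q r0 Lhat u = 0 by rewrite /ricci_field Lu subrr.
have sR := ricci_strict_derive Iu.
have sC : strict_derive (calabi_field q r0 Lhat) u (- (J u *m J u)).
  apply: (strict_derive_eq d0) (strict_derive_product sR R0 (loc_lip_J Iu)).
  by move=> v /Hd Iv; rewrite calabi_fieldE.
have C0 : calabi_field q r0 Lhat u = 0 by rewrite calabi_fieldE// R0 mul0mx oppr0.
have [V1 [nV1 V1U] H1] := strict_derive_stable d0 c0 dU sR R0 Hc.
have [V2 [nV2 V2U] H2] := strict_derive_stable d0 (exprn_gt0 2 c0) dU sC C0
  (symmetric_sqr_negative c0 (J_sym u) Hc).
exists (V1 `&` V2); first by split; [exact: filterI|move=> v [/V1U]].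
by move=> u0 [/H1 ? /H2 ?].
Qed.

End flows.

Theorem theorem4p3 (R : realType) (S : cell_decomposition)
    (q r0 : R) (Lhat : 'rV[R]_(nfaces S)) :
  even_faces S -> even_vertices S ->
  0 < q <= 1 -> 0 < r0 < pi / 2 ->
  (forall i, 0 < Lhat 0 i) ->
  let U : set 'rV[R]_(nfaces S) := admissible q r0 in
  let RF := ricci_field q r0 Lhat in
  let CF := calabi_field q r0 Lhat in
  (forall (u : R -> 'rV[R]_(nfaces S)) (uhat : 'rV[R]_(nfaces S)),
     is_solution RF U +oo%E u \/ is_solution CF U +oo%E u ->
     U uhat -> u t @[t --> +oo] --> uhat ->
     Lmap q r0 uhat = Lhat)
  /\
  (forall uhat : 'rV[R]_(nfaces S),
     U uhat -> Lmap q r0 uhat = Lhat ->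
     exists2 V : set 'rV[R]_(nfaces S), nbhs uhat V /\ V `<=` U &
       forall u0, V u0 ->
         solution_exp_converges RF U u0 uhat
         /\ solution_exp_converges CF U u0 uhat).
Proof.
move=> _ _ q01 r0_acute _ U RF CF; split=> [u uhat|uhat].
  exact: flow_limit.
exact: flow_stable.
Qed.
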